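(* Let $E$ and $F$ be order continuous Banach lattices. For an operator $T:E\to F$, the following assertions are equivalent: (1) $T$ is disjoint weak Banach-Saks. (2) For each sequence $(x_n)$ of $E^+$ that is weakly null and uo-null, $(T(x_n))$ has a subsequence whose Cesàro sequence is almost order bounded in $F$. (3) For each weakly null sequence $(x_n)$ of $E^+$, $(T(x_n))$ has a subsequence whose Cesàro sequence is almost order bounded in $F$.
   Context: An operator is a bounded linear map. A sequence $(x_n)$ in a Banach lattice is disjoint if $|x_n|\wedge|x_m|=0$ for $n\ne m$. The Cesàro sequence of $(y_k)$ is $\left(\frac1m\sum_{k=1}^m y_k\right)_m$. An operator $T:E\to F$ is disjoint weak Banach-Saks if for each disjoint weakly null sequence $(x_n)$ of $E$, $(T(x_n))$ has a subsequence whose Cesàro sequence is norm convergent in $F$. A Banach lattice is order continuous if $x_\alpha\downarrow 0$ implies $\|x_\alpha\|\to0$. A sequence $(x_n)$ is uo-null if $|x_n|\wedge u$ converges to $0$ in order for every $u\in E^+$. A subset $A$ of a Banach lattice $F$ (with closed unit ball $B_F$) is almost order bounded if for every $\varepsilon>0$ there is $u\in F^+$ with $A\subset[-u,u]+\varepsilon B_F$; a sequence is almost order bounded if its set of terms is. *)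

(* Defs.v *)
From HB Require Import structures.
From mathcomp Require Import all_boot all_order all_algebra.
From mathcomp Require Import all_classical all_reals.
From mathcomp Require Import topology normedtype sequences.

Set Implicit Arguments.
Unset Strict Implicit.
Unset Printing Implicit Defensive.

Import Order.TTheory GRing.Theory Num.Theory.
Import numFieldNormedType.Exports.

Local Open Scope classical_set_scope.
Local Open Scope ring_scope.

(* The order is part of the mixin instead of being inherited from
   [Order.Lattice], because Hierarchy-Builder lacks the joins between the
   lattice and the normed module structures.  The instances below make every
   Banach lattice a [latticeType ring_display], so that [<=], [Order.meet],
   [Order.join] and their theory are the library ones.
   In [bl_norm], [bl_join x (- x)] is the modulus of x in the lattice, whereas
   [`|x|] is its norm. *)
HB.mixin Record isBanachLattice (R : realType) E of CompleteNormedModule R E := {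
  bl_le : rel E;
  bl_meet : E -> E -> E;
  bl_join : E -> E -> E;
  bl_le_refl : reflexive bl_le;
  bl_le_anti : antisymmetric bl_le;
  bl_le_trans : transitive bl_le;
  bl_meetP : forall x y z : E, bl_le x (bl_meet y z) = bl_le x y && bl_le x z;
  bl_joinP : forall x y z : E, bl_le (bl_join x y) z = bl_le x z && bl_le y z;
  bl_leD2r : forall z x y : E, bl_le x y -> bl_le (x + z) (y + z);
  bl_leZ2l : forall (a : R) (x y : E),
    0 <= a -> bl_le x y -> bl_le (a *: x) (a *: y);
  bl_norm : forall x y : E,
    bl_le (bl_join x (- x)) (bl_join y (- y)) -> `|x| <= `|y|
}.

#[short(type="banachLatticeType")]
HB.structure Definition BanachLattice (R : realType) :=
  { E of CompleteNormedModule R E & isBanachLattice R E }.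

#[non_forgetful_inheritance, warning="-redundant-canonical-projection"]
HB.instance Definition _ (R : realType) (E : banachLatticeType R) :=
  Order.Le_isPOrder.Build ring_display (BanachLattice.sort E)
    (@bl_le_refl R E) (@bl_le_anti R E) (@bl_le_trans R E).

#[non_forgetful_inheritance, warning="-redundant-canonical-projection"]
HB.instance Definition _ (R : realType) (E : banachLatticeType R) :=
  Order.POrder_MeetJoin_isLattice.Build ring_display (BanachLattice.sort E)
    (@bl_meetP R E) (@bl_joinP R E).

Section BanachLatticeNotions.
Context (R : realType).
Implicit Types E F : banachLatticeType R.

(* The modulus in the lattice, not to be confused with the norm [`|x|]. *)
Definition modulus E (x : E) : E := Order.join x (- x).

Definition disjoint_seq E (x : nat -> E) : Prop :=
  forall m n, m != n -> Order.meet (modulus (x n)) (modulus (x m)) = 0.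

Definition directed (I : Type) (r : I -> I -> Prop) : Prop :=
  [/\ inhabited I,
      forall i, r i i,
      forall i j k, r i j -> r j k -> r i k
    & forall i j, exists k, r i k /\ r j k].

(* The net y, indexed by the directed set (I, r), decreases to 0. *)
Definition decreases_to0 E (I : Type) (r : I -> I -> Prop) (y : I -> E) : Prop :=
  [/\ directed r,
      forall i j, r i j -> y j <= y i
    & infimums (range y) 0].

Definition order_continuous E : Prop :=
  forall (I : Type) (r : I -> I -> Prop) (y : I -> E), decreases_to0 r y ->
  forall eps : R, 0 < eps ->
  exists i0, forall i, r i0 i -> `|y i| < eps.

(* Order convergence: the dominating net may have its own index set. *)
Definition order_converges E (x : nat -> E) (l : E) : Prop :=
  exists (I : Type) (r : I -> I -> Prop) (y : I -> E),
    decreases_to0 r y /\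
    forall i, exists N : nat, forall n, (N <= n)%N -> modulus (x n - l) <= y i.

Definition uo_null E (x : nat -> E) : Prop :=
  forall u : E, 0 <= u -> order_converges (fun n => Order.meet (modulus (x n)) u) 0.

Definition weakly_null E (x : nat -> E) : Prop :=
  forall f : {scalar E}, continuous f -> f \o x @ \oo --> (0 : R).

(* Sequences are indexed from 0: the m-th term is the mean of y_0, ..., y_m. *)
Definition cesaro_seq E (y : nat -> E) (m : nat) : E :=
  m.+1%:R^-1 *: series y m.+1.

Definition almost_order_bounded F (A : set F) : Prop :=
  forall eps : R, 0 < eps -> exists2 u : F, 0 <= u &
    A `<=` [set y + eps *: b | y in [set y : F | - u <= y <= u]
                             & b in [set b : F | `|b| <= 1]].

Definition bounded_operator E F (T : {linear E -> F}) : Prop :=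
  bounded_near T (nbhs (0 : E)).

Definition disjoint_weak_banach_saks E F (T : E -> F) : Prop :=
  forall x : nat -> E, disjoint_seq x -> weakly_null x ->
  exists2 phi : nat -> nat, increasing_seq phi &
    cvgn (cesaro_seq (T \o x \o phi)).

Definition has_aob_cesaro_subseq F (y : nat -> F) : Prop :=
  exists2 phi : nat -> nat, increasing_seq phi &
    almost_order_bounded (range (cesaro_seq (y \o phi))).

End BanachLatticeNotions.

(* Main.v *)
Require Import Defs.
From HB Require Import structures.
From mathcomp Require Import all_boot all_order all_algebra.
From mathcomp Require Import all_classical all_reals.
From mathcomp Require Import topology normedtype sequences.
From mathcomp Require Import lra ring.

Set Implicit Arguments.
Unset Strict Implicit.
Unset Printing Implicit Defensive.

Import Order.TTheory GRing.Theory Num.Theory.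
Import numFieldNormedType.Exports.

Local Open Scope classical_set_scope.
Local Open Scope ring_scope.

(** The implication from disjoint weak Banach-Saks operators to uo-null sequences
    is an almost disjointness argument: if x is positive, weakly null and
    uo-null, then |x_n /\ w| tends to 0 for every w >= 0, so some subsequence of
    x is a norm null perturbation of a disjoint sequence d
    ([almost_disjoint_subseq]).  As d is weakly null, T d has a subsequence with
    convergent Cesàro means, and Cesàro means of norm null sequences are norm
    null.

    The passage from uo-null sequences to all positive weakly null ones holds
    because a positive weakly null sequence of an order continuous Banach
    lattice has a uo-null subsequence ([weakly_null_uo_null_subseq]).  This rests
    on a substitute for the representation of the lattice as an ideal of L^1: for
    u >= 0 there is a positive functional f that controls the norm on [0, u]
    ([controlling_functional]).

    For the return to disjoint weakly null sequences x of arbitrary sign, the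
    positive and negative parts of x are again weakly null
    ([weakly_null_pospart]), and a common subsequence has to be found along which
    both images have Cesàro means tending to 0.  This follows if every positive
    weakly null sequence x has a subsequence for which the Cesàro means of the
    images under T tend to 0 along all further subsequences
    ([hereditary_cesaro_null_image]).  Let y = T x, let u dominate all |y_n| up
    to constants, and let f control the norm on [0, u].
    - The sequence y is uniformly integrable for the seminorm f |.|
      ([weakly_null_uniformly_integrable], by a gliding hump argument).
    - A Banach-Saks argument for L^1, carried out with lattice operations only,
      finds arbitrarily far finite sets of terms of y with small average for this
      seminorm ([uniformly_integrable_small_average]).
    - Ramsey's theorem makes this hereditary: some subsequence of y has all its
      subsequences Cesàro null for f |.| ([hereditary_cesaro_null]).
    - By hypothesis, each subsequence of the latter has a subsequence with almost
      order bounded Cesàro means; these tend to 0 in norm, as f controls the norm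
      ([almost_order_bounded_cvg0]).  A second use of Ramsey's theorem, now for
      the norm, concludes. *)

(** * Vector lattices *)

Section VectorLattice.
Context (R : realType) (E : banachLatticeType R).
Implicit Types x y z u v w : E.

Lemma bl_lerD2r z x y : (x + z <= y + z) = (x <= y).
Proof.
apply/idP/idP => h; last exact: bl_leD2r.
by have := bl_leD2r (- z) _ _ h; rewrite !addrK.
Qed.

Lemma bl_lerD2l z x y : (z + x <= z + y) = (x <= y).
Proof. by rewrite ![z + _]addrC bl_lerD2r. Qed.

Lemma bl_lerD x y z w : x <= y -> z <= w -> x + z <= y + w.
Proof. by move=> h1 h2; rewrite (@le_trans _ _ (y + z)) ?bl_lerD2r ?bl_lerD2l. Qed.

Lemma bl_subr_ge0 x y : (0 <= y - x) = (x <= y).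
Proof. by rewrite -(bl_lerD2r x 0) add0r subrK. Qed.

Lemma bl_lerBlDr x y z : (x - y <= z) = (x <= z + y).
Proof. by rewrite -(bl_lerD2r y (x - y)) subrK. Qed.

Lemma bl_lerBrDr x y z : (x <= y - z) = (x + z <= y).
Proof. by rewrite -(bl_lerD2r z x) subrK. Qed.

Lemma bl_lerN2 x y : (- x <= - y) = (y <= x).
Proof. by rewrite -(bl_subr_ge0 (- x)) opprK addrC bl_subr_ge0. Qed.

Lemma bl_lerNl x y : (- x <= y) = (- y <= x).
Proof. by rewrite -(bl_lerN2 y) opprK. Qed.

Lemma bl_addr_ge0 x y : 0 <= x -> 0 <= y -> 0 <= x + y.
Proof. by move=> h1 h2; rewrite -[0 in leLHS](addr0 0) bl_lerD. Qed.

Lemma bl_lerDl x y : 0 <= y -> x <= x + y.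
Proof. by move=> y0; rewrite -[leLHS]addr0 bl_lerD2l. Qed.

Lemma bl_oppr_le0 x : (- x <= 0) = (0 <= x).
Proof. by rewrite -bl_lerN2 opprK oppr0. Qed.

Lemma bl_ler_wpZ2l (a : R) x y : 0 <= a -> x <= y -> a *: x <= a *: y.
Proof. exact: bl_leZ2l. Qed.

Lemma bl_scaler_ge0 (a : R) x : 0 <= a -> 0 <= x -> 0 <= a *: x.
Proof. by move=> h1 h2; rewrite -(scaler0 _ a) bl_ler_wpZ2l. Qed.

Lemma bl_ler_pZ2l (a : R) x y : 0 < a -> (a *: x <= a *: y) = (x <= y).
Proof.
move=> a0; apply/idP/idP => h; last exact: bl_ler_wpZ2l (ltW _) _.
have : a^-1 *: (a *: x) <= a^-1 *: (a *: y) by rewrite bl_ler_wpZ2l// invr_ge0 ltW.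
by rewrite !scalerA mulVf ?gt_eqF// !scale1r.
Qed.

Lemma bl_ler_wZ2r (a b : R) x : 0 <= x -> a <= b -> a *: x <= b *: x.
Proof.
by move=> x0 ab; rewrite -bl_subr_ge0 -scalerBl bl_scaler_ge0// subr_ge0.
Qed.

Lemma bl_sumr_ge0 (I : Type) (s : seq I) (P : pred I) (f : I -> E) :
  (forall i, P i -> 0 <= f i) -> 0 <= \sum_(i <- s | P i) f i.
Proof. by move=> h; elim/big_ind : _ => //; exact: bl_addr_ge0. Qed.

Lemma bl_ler_sum (I : Type) (s : seq I) (P : pred I) (f g : I -> E) :
  (forall i, P i -> f i <= g i) ->
  \sum_(i <- s | P i) f i <= \sum_(i <- s | P i) g i.
Proof. by move=> h; elim/big_ind2 : _ => // *; exact: bl_lerD. Qed.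

Lemma bl_joinDr x y z : Order.join x y + z = Order.join (x + z) (y + z).
Proof.
apply/le_anti/andP; split; last by rewrite leUx !bl_lerD2r leUl leUr.
by rewrite -bl_lerBrDr leUx !bl_lerBrDr leUl leUr.
Qed.

Lemma bl_meetDr x y z : Order.meet x y + z = Order.meet (x + z) (y + z).
Proof.
apply/le_anti/andP; split; first by rewrite lexI !bl_lerD2r leIl leIr.
by rewrite -bl_lerBlDr lexI !bl_lerBlDr leIl leIr.
Qed.

Lemma bl_oppI x y : - Order.meet x y = Order.join (- x) (- y).
Proof.
apply/le_anti/andP; split; last by rewrite leUx !bl_lerN2 leIl leIr.
by rewrite bl_lerNl lexI !(bl_lerNl (Order.join _ _)) leUl leUr.
Qed.

Lemma bl_oppU x y : - Order.join x y = Order.meet (- x) (- y).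
Proof. by rewrite -[RHS]opprK bl_oppI !opprK. Qed.

Lemma bl_addUI x y : Order.join x y + Order.meet x y = x + y.
Proof.
apply/(addIr (- Order.meet x y)); rewrite addrK bl_oppI addrC bl_joinDr.
by rewrite addrA addNr add0r [x + y]addrC addrA addNr add0r joinC.
Qed.

Lemma bl_scaleU (a : R) x y : 0 <= a ->
  a *: Order.join x y = Order.join (a *: x) (a *: y).
Proof.
rewrite le_eqVlt => /predU1P[<-|a0]; first by rewrite !scale0r joinxx.
apply/le_anti/andP; split; last first.
  by rewrite leUx !bl_ler_wpZ2l ?leUl ?leUr// ltW.
have aV z : z = a *: (a^-1 *: z) by rewrite scalerA divff ?gt_eqF// scale1r.
rewrite [leRHS]aV bl_ler_pZ2l// leUx.
by rewrite -(bl_ler_pZ2l x _ a0) -(bl_ler_pZ2l y _ a0) -aV leUl leUr.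
Qed.

Lemma bl_scaleI (a : R) x y : 0 <= a ->
  a *: Order.meet x y = Order.meet (a *: x) (a *: y).
Proof.
by move=> a0; rewrite -[LHS]opprK -scalerN bl_oppI bl_scaleU// bl_oppU !scalerN !opprK.
Qed.

(** The positive part of x; its negative part is [pospart (- x)]. *)
Definition pospart x : E := Order.join x 0.

Lemma pospart_ge0 x : 0 <= pospart x. Proof. exact: leUr. Qed.
Lemma pospart_ge x : x <= pospart x. Proof. exact: leUl. Qed.

Lemma pospart_id x : 0 <= x -> pospart x = x.
Proof. by move=> /join_idPr; rewrite /pospart joinC. Qed.

Lemma pospart_le0 x : x <= 0 -> pospart x = 0.
Proof. by move=> /join_idPr; rewrite /pospart. Qed.

Lemma le_pospart x y : x <= y -> pospart x <= pospart y.
Proof. by move=> xy; rewrite leUx (le_trans xy) ?leUl ?leUr. Qed.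

Lemma pospart_le x y : 0 <= y -> x <= y -> pospart x <= y.
Proof. by move=> y0 xy; rewrite leUx xy y0. Qed.

Lemma pospartB x : pospart x - pospart (- x) = x.
Proof.
apply/eqP; rewrite subr_eq /pospart addrC bl_joinDr addNr add0r.
by rewrite joinC.
Qed.

Lemma pospartZ (a : R) x : 0 <= a -> pospart (a *: x) = a *: pospart x.
Proof. by move=> a0; rewrite /pospart bl_scaleU// scaler0. Qed.

Lemma pospartD x y : pospart (x + y) <= pospart x + pospart y.
Proof. by rewrite pospart_le ?bl_addr_ge0 ?pospart_ge0// bl_lerD ?pospart_ge. Qed.

Lemma bl_subr_pospart x y : x - pospart (x - y) = Order.meet x y.
Proof.
rewrite /pospart bl_oppU oppr0 opprB addrC bl_meetDr subrK add0r.
by rewrite meetC.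
Qed.

Lemma modulus_ge x : x <= modulus x. Proof. exact: leUl. Qed.
Lemma modulus_geN x : - x <= modulus x. Proof. exact: leUr. Qed.

Lemma modulusN x : modulus (- x) = modulus x.
Proof. by rewrite /modulus opprK joinC. Qed.

Lemma modulus_leP x y : reflect (x <= y /\ - x <= y) (modulus x <= y).
Proof. by rewrite leUx; exact: andP. Qed.

Lemma pospartN x : pospart (- x) = pospart x - x.
Proof. by rewrite -{3}[x]pospartB opprB addrC subrK. Qed.

Lemma modulusE x : modulus x = pospart x + pospart (- x).
Proof.
apply: (addIr x); rewrite bl_joinDr addNr -addrA pospartN subrK.
by rewrite -mulr2n -scaler_nat -[x + x]mulr2n -scaler_nat -pospartZ ?ler0n.
Qed.

Lemma modulus_ge0 x : 0 <= modulus x.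
Proof. by rewrite modulusE bl_addr_ge0// pospart_ge0. Qed.

Lemma modulus_id x : 0 <= x -> modulus x = x.
Proof.
move=> x0; apply/le_anti; rewrite modulus_ge andbT; apply/modulus_leP; split=> //.
by rewrite (le_trans _ x0)// bl_oppr_le0.
Qed.

Lemma pospart_le_modulus x : pospart x <= modulus x.
Proof. by rewrite modulusE bl_lerDl// pospart_ge0. Qed.

Lemma modulusD x y : modulus (x + y) <= modulus x + modulus y.
Proof.
apply/modulus_leP; split; first by rewrite bl_lerD// modulus_ge.
by rewrite opprD bl_lerD// modulus_geN.
Qed.

Lemma modulusZ (a : R) x : modulus (a *: x) = `|a| *: modulus x.
Proof.
have [a0|a0] := leP 0 a; first by rewrite /modulus bl_scaleU// scalerN ger0_norm.
rewrite ltr0_norm// /modulus bl_scaleU ?oppr_ge0 1?ltW//.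
by rewrite scalerN !scaleNr opprK joinC.
Qed.

Lemma modulus_sum (I : Type) (s : seq I) (P : pred I) (f : I -> E) :
  modulus (\sum_(i <- s | P i) f i) <= \sum_(i <- s | P i) modulus (f i).
Proof.
elim/big_rec2 : _ => [|i y x _ h]; first by rewrite modulus_id.
by rewrite (le_trans (modulusD _ _))// bl_lerD.
Qed.

(** The identity |x + y| + |x - y| = 2 (|x| \/ |y|). *)
Lemma modulusDB x y : modulus (x + y) + modulus (x - y) =
  2 *: Order.join (modulus x) (modulus y).
Proof.
have jD (a b c d : E) : Order.join a b + Order.join c d =
    Order.join (Order.join (a + c) (a + d)) (Order.join (b + c) (b + d)).
  by rewrite bl_joinDr ![_ + Order.join c d]addrC !bl_joinDr ![c + _]addrC ![d +
    _]addrC.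
rewrite jD !bl_scaleU ?ler0n//.
have -> : x + y + (x - y) = 2 *: x by rewrite addrACA subrr addr0 scaler_nat.
have -> : x + y + - (x - y) = 2 *: y.
  by rewrite opprB addrACA [x + y]addrC addrACA subrr addr0 scaler_nat.
have -> : - (x + y) + (x - y) = 2 *: - y.
  by rewrite opprD addrACA addNr add0r scaler_nat.
have -> : - (x + y) + - (x - y) = 2 *: - x.
  by rewrite opprD opprB [y - x]addrC addrACA addNr addr0 scaler_nat.
by rewrite [Order.join (2 *: - y) _]joinC joinACA.
Qed.

(** ** Disjointness *)

Lemma meet_addl x y z : 0 <= x -> 0 <= y -> 0 <= z ->
  Order.meet (x + y) z <= Order.meet x z + Order.meet y z.
Proof.
move=> x0 y0 z0; rewrite bl_meetDr lexI.
rewrite ![_ + Order.meet y z]addrC !bl_meetDr !lexI.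
rewrite [y + x]addrC leIl/= (le_trans (leIr _ _))/= ?bl_lerDl//.
rewrite (le_trans (leIr _ _)) /=; last by rewrite addrC bl_lerDl.
by rewrite (le_trans (leIr _ _))// bl_lerDl.
Qed.

Lemma meet_ge0 x y : 0 <= x -> 0 <= y -> 0 <= Order.meet x y.
Proof. by move=> x0 y0; rewrite lexI x0. Qed.

Lemma meet_scale_le (a : R) x z : 1 <= a -> 0 <= x -> 0 <= z ->
  Order.meet (a *: x) z <= a *: Order.meet x z.
Proof.
move=> a1 x0 z0; rewrite bl_scaleI ?(le_trans ler01)// leI2//.
by rewrite -{1}[z]scale1r bl_ler_wZ2r.
Qed.

(** Two positive elements are disjoint when their meet is 0. *)
Lemma meet0_le x y x' y' : 0 <= x' -> 0 <= y' -> x' <= x -> y' <= y ->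
  Order.meet x y = 0 -> Order.meet x' y' = 0.
Proof.
move=> x0 y0 xx yy h; apply/le_anti; rewrite meet_ge0// andbT -h.
exact: leI2.
Qed.

Lemma meet0D x y z : 0 <= x -> 0 <= y -> 0 <= z ->
  Order.meet x z = 0 -> Order.meet y z = 0 -> Order.meet (x + y) z = 0.
Proof.
move=> x0 y0 z0 xz yz; apply/le_anti; rewrite meet_ge0 ?bl_addr_ge0// andbT.
by rewrite (le_trans (meet_addl _ _ _))// xz yz addr0.
Qed.

Lemma meet0Z (a : R) x z : 0 <= a -> 0 <= x -> 0 <= z ->
  Order.meet x z = 0 -> Order.meet (a *: x) z = 0.
Proof.
move=> a0 x0 z0 xz; have a1 : 1 <= a + 1 by rewrite lerDr.
apply: (@meet0_le ((a + 1) *: x) z) => //.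
- exact: bl_scaler_ge0.
- by rewrite bl_ler_wZ2r// lerDl.
apply/le_anti; rewrite meet_ge0 ?bl_scaler_ge0 ?(le_trans ler01)// andbT.
by rewrite (le_trans (meet_scale_le _ _ _))// xz scaler0.
Qed.

Lemma meet0_sum (I : eqType) (s : seq I) (P : pred I) (f : I -> E) z : 0 <= z ->
  (forall i, i \in s -> P i -> 0 <= f i /\ Order.meet (f i) z = 0) ->
  0 <= \sum_(i <- s | P i) f i /\ Order.meet (\sum_(i <- s | P i) f i) z = 0.
Proof.
move=> z0 h; rewrite big_seq_cond.
elim/big_ind : _ => [|x y [x0 xz] [y0 yz]|i /andP[]]; last exact: h.
- by split=> //; rewrite meet_l.
- by split; [exact: bl_addr_ge0|exact: meet0D].
Qed.

Lemma meet0_join x y : Order.meet x y = 0 -> Order.join x y = x + y.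
Proof. by move=> xy; rewrite -bl_addUI xy addr0. Qed.

Lemma modulus_meet0 x y : Order.meet x y = 0 -> modulus (x - y) = x + y.
Proof.
move=> xy; rewrite modulusE -opprB pospartN opprB.
have -> : pospart (x - y) = x by rewrite -[LHS](subKr x) bl_subr_pospart xy subr0.
by rewrite subKr.
Qed.

Lemma pospart_meet0 x : Order.meet (pospart x) (pospart (- x)) = 0.
Proof.
by rewrite -bl_subr_pospart pospartB subrr.
Qed.

Lemma pospartB_meet0 x y : Order.meet (pospart (x - y)) (pospart (y - x)) = 0.
Proof. by rewrite -[y - x]opprB pospart_meet0. Qed.

(** ** The norm *)

Lemma bl_norm_le x y : modulus x <= modulus y -> `|x| <= `|y|.
Proof. exact: bl_norm. Qed.

Lemma bl_norm_le_pos x y : 0 <= x -> x <= y -> `|x| <= `|y|.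
Proof.
by move=> x0 xy; apply: bl_norm_le; rewrite !modulus_id// (le_trans x0).
Qed.

Lemma norm_modulus x : `|modulus x| = `|x|.
Proof.
have h : modulus (modulus x) = modulus x by rewrite modulus_id// modulus_ge0.
by apply/le_anti; rewrite !bl_norm_le// h.
Qed.

Lemma bl_norm_modulus_le x y : modulus x <= y -> `|x| <= `|y|.
Proof.
move=> xy; rewrite -norm_modulus; apply: bl_norm_le_pos => //; exact: modulus_ge0.
Qed.

Lemma norm_pospart x : `|pospart x| <= `|x|.
Proof.
by rewrite -(norm_modulus x) bl_norm_le_pos ?pospart_ge0// pospart_le_modulus.
Qed.

Lemma norm_pospartB x y : `|pospart x - pospart y| <= `|x - y|.
Proof.
rewrite -(norm_modulus (x - y)); apply: bl_norm_modulus_le.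
have h a b : pospart a - pospart b <= modulus (a - b).
  rewrite bl_lerBlDr pospart_le ?bl_addr_ge0 ?modulus_ge0 ?pospart_ge0//.
  by rewrite -[leLHS](subrK b) bl_lerD ?modulus_ge ?pospart_ge.
by apply/modulus_leP; rewrite opprB; split=> //; rewrite -modulusN opprB.
Qed.

Lemma bl_archimedean x y : (forall n : nat, n%:R *: x <= y) -> x <= 0.
Proof.
move=> h; have px n : `|pospart x| *+ n <= `|pospart y|.
  rewrite -normrMn -scaler_nat -pospartZ ?ler0n// bl_norm_le_pos ?pospart_ge0//.
  exact: le_pospart.
have [p0|p0] := eqVneq (pospart x) 0; first by rewrite -p0 pospart_ge.
have := px (Num.truncn (`|pospart y| / `|pospart x|)).+1.
rewrite -mulr_natr mulrC -ler_pdivlMr ?normr_gt0// leNgt.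
by rewrite truncnS_gt// divr_ge0.
Qed.

Lemma cvg_bl_ge0 (z : nat -> E) (l : E) : z @ \oo --> l ->
  (\forall n \near \oo, 0 <= z n) -> 0 <= l.
Proof.
move=> zl z0; rewrite -bl_oppr_le0.
suff <- : pospart (- l) = 0 by exact: pospart_ge.
apply/normr0_eq0/le_anti; rewrite normr_ge0 andbT.
apply/ler_addgt0Pl => e e0; rewrite addr0.
have /cvgrPdist_le /(_ e e0) := zl => {}zl.
near \oo => n.
rewrite -[pospart _]subr0 -(@pospart_le0 (- z n)) ?bl_oppr_le0; last by near: n.
by rewrite (le_trans (norm_pospartB _ _))// -opprD normrN; near: n.
Unshelve. all: by end_near. Qed.

Lemma cvg_bl_le (z z' : nat -> E) (l l' : E) : z @ \oo --> l -> z' @ \oo --> l' ->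
  (\forall n \near \oo, z n <= z' n) -> l <= l'.
Proof.
move=> zl zl' h; rewrite -bl_subr_ge0; apply: (cvg_bl_ge0 (cvgB zl' zl)).
by near=> n; rewrite /= bl_subr_ge0; near: n.
Unshelve. all: by end_near. Qed.

End VectorLattice.

(** * Sublinear functionals and the Hahn-Banach theorem *)

Section HahnBanach.
Context (R : realType) (V : lmodType R).
Implicit Types (p q : V -> R) (x y : V).

(** Subadditive and positively homogeneous functions. *)
Definition sublinear p :=
  (forall x y, p (x + y) <= p x + p y) /\
  (forall (t : R) x, 0 <= t -> p (t *: x) = t * p x).

Lemma sublinear0 p : sublinear p -> p 0 = 0.
Proof. by case=> _ h; rewrite -(scale0r 0) h ?mul0r. Qed.

Lemma sublinear_ge p x : sublinear p -> - p (- x) <= p x.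
Proof.
move=> sp; rewrite -subr_ge0 opprK -(sublinear0 sp) -(subrr x).
exact: sp.1.
Qed.

(** Infima of suitably additive families of sets are sublinear. *)
Lemma sublinear_inf (S : V -> set R) :
  (forall x, S x !=set0) -> (forall x, has_lbound (S x)) ->
  lbound (S 0) 0 ->
  (forall x y a b, S x a -> S y b -> exists2 c, S (x + y) c & c <= a + b) ->
  (forall t x a, 0 < t -> S x a -> exists2 c, S (t *: x) c & c <= t * a) ->
  S 0 0 ->
  sublinear (fun x => inf (S x)).
Proof.
move=> S0 Slb S00 SD SZ S000; split=> [x y|].
  rewrite -lerBlDr; apply: lb_le_inf => // a Sa.
  rewrite lerBlDr -lerBlDl; apply: lb_le_inf => // b Sb.
  rewrite lerBlDl; have [c Sc] := SD _ _ _ _ Sa Sb.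
  by apply: le_trans; exact: ge_inf.
have le t x : 0 < t -> inf (S (t *: x)) <= t * inf (S x).
  move=> t0; rewrite mulrC -ler_pdivrMr//; apply: lb_le_inf => // a Sa.
  rewrite ler_pdivrMr// mulrC; have [c Sc] := SZ _ _ _ t0 Sa.
  by apply: le_trans; exact: ge_inf.
move=> t x; rewrite le_eqVlt => /predU1P[<-|t0].
  rewrite scale0r mul0r; apply/le_anti/andP; split; first exact: ge_inf.
  exact: lb_le_inf.
apply/le_anti/andP; split; first exact: le.
have := le t^-1 (t *: x); rewrite invr_gt0 => /(_ t0).
rewrite scalerA mulVf ?gt_eqF// scale1r => h.
by rewrite mulrC -ler_pdivlMr// mulrC.
Qed.

(** A sublinear functional below q whose value at - a is at most - q a.  It
    differs from q unless q is additive along a. *)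
Definition sublinear_along q (a : V) x :=
  inf [set q (x + t *: a) - t * q a | t in [set t : R | 0 <= t]].

Lemma sublinear_along_has_lbound q a x : sublinear q ->
  has_lbound [set q (x + t *: a) - t * q a | t in [set t : R | 0 <= t]].
Proof.
move=> sq; exists (- q (- x)) => _ [t t0 <-].
have := sq.1 (x + t *: a) (- x); rewrite addrAC subrr add0r sq.2//; lra.
Qed.

Lemma sublinear_alongP q a : sublinear q -> sublinear (sublinear_along q a).
Proof.
move=> sq; apply: sublinear_inf =>
  [x|x||x y _ _ [t t0 <-] [s s0 <-]|s x _ s0 [t t0 <-]|].
- by exists (q (x + 0 *: a) - 0 * q a), 0 => /=.
- exact: sublinear_along_has_lbound.
- by move=> _ [t t0 <-]; rewrite add0r sq.2// subrr.
- exists (q (x + y + (t + s) *: a) - (t + s) * q a); first by exists (t + s) => //=;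
  exact: addr_ge0.
  have := sq.1 (x + t *: a) (y + s *: a).
  by rewrite addrACA -scalerDl; lra.
- exists (q (s *: x + (s * t) *: a) - (s * t) * q a); first by exists (s * t) => //=;
  rewrite mulr_ge0// ltW.
  by rewrite -scalerA -scalerDr sq.2 ?(ltW s0)// mulrBr mulrA.
- by exists 0 => //=; rewrite scale0r addr0 mul0r subr0 sublinear0.
Qed.

Lemma sublinear_along_le q a x (t : R) : sublinear q -> 0 <= t ->
  sublinear_along q a x <= q (x + t *: a) - t * q a.
Proof.
by move=> sq t0; apply: ge_inf; [exact: sublinear_along_has_lbound|exists t].
Qed.

(** By Zorn's lemma: the infimum of a chain of sublinear functionals below p is
    sublinear. *)
Lemma minimal_sublinear p : sublinear p -> exists q,
  [/\ sublinear q, forall x, q x <= p x &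
      forall r, sublinear r -> (forall x, r x <= q x) -> r = q].
Proof.
move=> sp.
pose T := {q : V -> R | sublinear q /\ forall x, q x <= p x}.
pose Rel (a b : T) := `[< forall x, sval b x <= sval a x >].
have [| | | |[q [sq qp]] qmin] := @Zorn T Rel.
- by move=> a; apply/asboolP.
- move=> a b c /asboolP ab /asboolP bc; apply/asboolP => x.
  exact: le_trans (bc x) (ab x).
- move=> a b /asboolP ab /asboolP ba; apply/eq_sig_hprop => [c|];
  first exact: Prop_irrelevance.
  apply/funext => x.
  by apply/le_anti; rewrite ab ba.
- move=> A tA; have [[a0 Aa0]|A0] := pselect (A !=set0); last first.
    exists (exist _ p (conj sp (fun x => lexx (p x)))) => s As.
    by exfalso; apply: A0; exists s.
  pose S x := [set sval a x | a in A].
  have Slb x : has_lbound (S x).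
    exists (- p (- x)) => _ [[a [sa ap]] _ <-] /=.
    by rewrite (le_trans _ (sublinear_ge _ sa))// lerN2.
  have sS : sublinear (fun x => inf (S x)).
    apply: sublinear_inf => //.
    + by move=> x; exists (sval a0 x), a0.
    + by move=> _ [[a [sa ap]] _ <-] /=; rewrite sublinear0.
    + move=> x y _ _ [a Aa <-] [b Ab <-].
      have [/asboolP ab|/asboolP ba] := tA a b Aa Ab.
      * exists (sval b (x + y)); first by exists b.
        by rewrite (le_trans ((svalP b).1.1 _ _))// lerD2r.
      * exists (sval a (x + y)); first by exists a.
        by rewrite (le_trans ((svalP a).1.1 _ _))// lerD2l.
    + move=> t x _ t0 [a Aa <-]; exists (sval a (t *: x)); first by exists a.
      by rewrite (svalP a).1.2// ltW.
    + by exists a0 => //; rewrite sublinear0//; exact: (svalP a0).1.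
  have Sp x : inf (S x) <= p x.
    by rewrite (le_trans _ ((svalP a0).2 x))//; apply: ge_inf => //; exists a0.
  exists (exist (fun q => sublinear q /\ forall x, q x <= p x) _ (conj sS Sp)) =>
    s As; apply/asboolP => x /=.
  by apply: ge_inf => //; exists s.
exists q; split=> // r sr rq.
have rp x : r x <= p x by exact: le_trans (rq x) (qp x).
by have /(congr1 sval) := qmin (exist _ r (conj sr rp)) (introT (asboolP _) rq).
Qed.

(** By minimality, [sublinear_along q a] is q for all a, so q is additive. *)
Lemma minimal_sublinear_linear q : sublinear q ->
  (forall r, sublinear r -> (forall x, r x <= q x) -> r = q) -> scalar q.
Proof.
move=> sq qmin.
have qD x a : q (x + a) = q x + q a.
  apply/le_anti; rewrite sq.1/=.
  have e : sublinear_along q a = q.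
    apply: qmin => [|y]; first exact: sublinear_alongP.
    have := @sublinear_along_le q a y 0 sq (lexx _).
    by rewrite scale0r addr0 mul0r subr0.
  have := @sublinear_along_le q a x 1 sq ler01.
  by rewrite e scale1r mul1r lerBrDr.
have qN x : q (- x) = - q x.
  by apply/eqP; rewrite -addr_eq0 -qD addNr sublinear0.
move=> t x y; rewrite qD; congr (_ + _).
have [t0|t0] := leP 0 t; first exact: sq.2.
rewrite -[t]opprK scaleNr qN sq.2 ?mulNr// oppr_ge0; exact: ltW.
Qed.

(** The Hahn-Banach theorem: a minimal sublinear functional below
    [sublinear_along p x0] is linear and supports p at x0. *)
Theorem hahn_banach p x0 : sublinear p ->
  exists f : {scalar V}, (forall x, f x <= p x) /\ f x0 = p x0.
Proof.
move=> sp.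
have sr := sublinear_alongP x0 sp.
have rp x : sublinear_along p x0 x <= p x.
  have := @sublinear_along_le p x0 x 0 sp (lexx _).
  by rewrite scale0r addr0 mul0r subr0.
have [q [sq qr qmin]] := minimal_sublinear sr.
pose f : {scalar V} := HB.pack q (GRing.isLinear.Build R V R *%R q
  (minimal_sublinear_linear sq qmin)).
exists f; split=> [x|]; first exact: le_trans (qr x) (rp x).
apply/le_anti/andP; split; first exact: le_trans (qr x0) (rp x0).
rewrite -lerN2 -[leLHS](raddfN f) (le_trans (qr _))//.
have := @sublinear_along_le p x0 (- x0) 1 sp ler01.
by rewrite scale1r addNr mul1r sublinear0// sub0r.
Qed.

End HahnBanach.

(** * Extraction of subsequences *)

(** Greedy extraction: the condition on the next index depends on the list of
    the indices already chosen. *)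
Lemma fast_subseq (P : seq nat -> nat -> Prop) :
  (forall s, \forall n \near \oo, P s n) ->
  exists2 phi, increasing_seq phi & forall k, P (mkseq phi k) (phi k).
Proof.
move=> h.
have /choice[N PN] : forall s, exists N, forall n, (N <= n)%N -> P s n.
  by move=> s; have [N _ hN] := h s; exists N => n Nn; exact: hN.
pose next s := maxn (N s) (last 0 s).+1.
pose L := fix L k := if k is k'.+1 then rcons (L k') (next (L k')) else [::].
pose phi k := next (L k).
have Lphi k : mkseq phi k = L k by elim: k => //= k ih; rewrite mkseqS ih.
exists phi; last by move=> k; rewrite Lphi; apply: PN; exact: leq_maxl.
apply/increasing_seqP => k; rewrite /phi /next /= last_rcons.
by rewrite ltEnat/= leq_max ltnS leqnn orbT.
Qed.

Lemma frequent_subseq (P : nat -> nat -> Prop) :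
  (forall k N, exists2 n, (N <= n)%N & P k n) ->
  exists2 phi, increasing_seq phi & forall k, P k (phi k).
Proof.
move=> h.
have /choice[next Pn] : forall c : nat * nat, exists n, (c.2 <= n)%N /\ P c.1 n.
  by move=> [k N]; have [n Nn Pn] := h k N; exists n.
pose phi := fix phi k := next (k, if k is k'.+1 then (phi k').+1 else 0%N).
exists phi; last by case=> [|k];
  [exact: (Pn (0, 0)%N).2|exact: (Pn (k.+1, (phi k).+1)).2].
by apply/increasing_seqP => k; exact: (Pn (k.+1, (phi k).+1)).1.
Qed.

Lemma increasing_seq_ge phi : increasing_seq phi -> forall n, (n <= phi n)%N.
Proof.
move=> /increasing_seqP h; elim=> // n ih; apply: leq_ltn_trans ih _.
exact: h.
Qed.

Lemma increasing_seq_comp (phi psi : nat -> nat) :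
  increasing_seq phi -> increasing_seq psi -> increasing_seq (phi \o psi).
Proof. by move=> h1 h2 m n /=; exact: etrans (h1 _ _) (h2 _ _). Qed.

Lemma increasing_seq_addn N : increasing_seq (addn N).
Proof. by move=> i j; exact: leq_add2l. Qed.

Lemma increasing_seq_cvg phi : increasing_seq phi -> phi @ \oo --> \oo.
Proof.
move=> h A [N _ AN]; exists N => // n /= Nn; apply: AN => /=.
by rewrite (leq_trans Nn)// increasing_seq_ge.
Qed.

Lemma not_near_subseq (P : nat -> Prop) : ~ (\forall n \near \oo, P n) ->
  exists2 phi, increasing_seq phi & forall k, ~ P (phi k).
Proof.
move=> h; apply: (@frequent_subseq (fun _ n => ~ P n)) => _ N.
apply: contrapT => h'; apply: h; exists N => // n /= Nn.
by apply: contrapT => Pn; apply: h'; exists n.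
Qed.

Lemma sum_subseq_le (R : realType) (f : nat -> R) phi N :
  (forall i, 0 <= f i) -> increasing_seq phi ->
  \sum_(i < N) f (phi i) <= \sum_(i < phi N) f i.
Proof.
move=> f0 hphi.
have mon m n : (m <= n)%N -> \sum_(i < m) f i <= \sum_(i < n) f i.
  move=> mn; rewrite -(subnKC mn) big_split_ord/= lerDl.
  exact: sumr_ge0.
elim: N => [|N ih]; first by rewrite big_ord0 sumr_ge0.
rewrite big_ord_recr/= (le_trans (lerD ih (lexx _)))//.
have -> : \sum_(i < phi N) f i + f (phi N) = \sum_(i < (phi N).+1) f i.
  by rewrite big_ord_recr.
apply: mon.
by move/increasing_seqP: hphi; exact.
Qed.

Lemma sum_half_le (R : realType) N : \sum_(i < N) 2^-1 ^+ i <= 2 :> R.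
Proof.
have -> : \sum_(i < N) 2^-1 ^+ i = 2 * (1 - 2^-1 ^+ N) :> R.
  elim: N => [|N ih]; first by rewrite big_ord0 expr0 subrr mulr0.
  by rewrite big_ord_recr/= ih exprS; field.
by rewrite ler_piMr// gerBl exprn_ge0// invr_ge0.
Qed.

(** * Weakly null sequences *)

Section Functionals.
Context (R : realType) (V : normedModType R).

Lemma bounded_scalar_continuous (f : {scalar V}) (M : R) :
  (forall x, `|f x| <= M * `|x|) -> continuous f.
Proof.
move=> fM x; apply/cvgrPdist_le => e e0.
have M0 : 0 < `|M| + 1 by rewrite ltr_wpDl.
near=> t; rewrite -raddfB (le_trans (fM _))//.
rewrite (@le_trans _ _ ((`|M| + 1) * `|x - t|))//.
  by rewrite ler_wpM2r// (le_trans (ler_norm _))// lerDl.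
rewrite mulrC -ler_pdivlMr//; near: t.
by apply: cvgr_dist_le => //; rewrite divr_gt0.
Unshelve. all: by end_near. Qed.

Lemma continuous_scalar_bounded (f : {scalar V}) : continuous f ->
  exists2 M : R, 0 < M & forall x, `|f x| <= M * `|x|.
Proof.
move=> /(_ 0); rewrite /continuous_at raddf0 => /cvgrPdist_le /(_ 1 ltr01).
rewrite -nbhs_nbhs_norm => -[e /= e0 he].
exists (2 / e); first by rewrite divr_gt0.
move=> x; have [->|x0] := eqVneq x 0; first by rewrite raddf0 !normr0 mulr0.
have nx : 0 < `|x| by rewrite normr_gt0.
pose t : R := e / 2 / `|x|; have t0 : 0 < t by rewrite !divr_gt0.
have := he (t *: x); rewrite /= sub0r normrN normrZ gtr0_norm// mulfVK ?gt_eqF//.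
rewrite sub0r normrN linearZ/= normrM (gtr0_norm t0).
move=> /(_ _)/wrap[]; first by rewrite gtr_pMr// invf_lt1// ltr1n.
rewrite mulrC -ler_pdivlMr// => /le_trans; apply.
by rewrite /t !invf_div mul1r mulrA [`|x| * 2]mulrC mulrAC.
Qed.

(** Seminorms; they are nonnegative. *)
Definition seminorm (p : V -> R) :=
  (forall x y, p (x + y) <= p x + p y) /\
  (forall (t : R) x, p (t *: x) = `|t| * p x).

Lemma seminorm_sublinear p : seminorm p -> sublinear p.
Proof. by case=> h1 h2; split=> // t x t0; rewrite h2 ger0_norm. Qed.

Lemma seminormN p x : seminorm p -> p (- x) = p x.
Proof. by case=> _ h; rewrite -scaleN1r h normrN1 mul1r. Qed.

Lemma seminorm0 p : seminorm p -> p 0 = 0.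
Proof. by move=> /seminorm_sublinear/sublinear0. Qed.

Lemma seminorm_ge0 p x : seminorm p -> 0 <= p x.
Proof.
move=> sp; have := sp.1 x (- x); rewrite subrr seminorm0// seminormN//.
by rewrite -mulr2n pmulrn_lge0.
Qed.

Lemma seminorm_sum p (I : Type) (s : seq I) (P : pred I) (f : I -> V) :
  seminorm p -> p (\sum_(i <- s | P i) f i) <= \sum_(i <- s | P i) p (f i).
Proof.
move=> sp; elim/big_rec2 : _ => [|i y x _ h]; first by rewrite seminorm0.
by rewrite (le_trans (sp.1 _ _))// lerD2l.
Qed.

Lemma seminorm_norm : seminorm (fun x : V => `|x|).
Proof. by split=> [x y|t x]; [exact: ler_normD|exact: normrZ]. Qed.

Lemma scalar_le_seminorm p (f : {scalar V}) : seminorm p ->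
  (forall x, f x <= p x) -> forall x, `|f x| <= p x.
Proof.
by move=> sp fp x; rewrite ler_norml fp andbT lerNl -raddfN -(seminormN x sp) fp.
Qed.

Lemma seminorm_dominated_continuous p (f : {scalar V}) (C : R) : seminorm p ->
  (forall x, f x <= p x) -> (forall x, p x <= C * `|x|) -> continuous f.
Proof.
move=> sp fp pC; apply: (@bounded_scalar_continuous _ C) => x.
by rewrite (le_trans _ (pC x))// scalar_le_seminorm.
Qed.

End Functionals.

Section WeaklyNull.
Context (R : realType) (E : banachLatticeType R).
Implicit Types (x y : nat -> E).

Lemma weakly_null_subseq x phi :
  increasing_seq phi -> weakly_null x -> weakly_null (x \o phi).
Proof.
move=> hphi wx f fc; apply: (cvg_comp phi (f \o x)); last exact: wx.
exact: increasing_seq_cvg.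
Qed.

Lemma weakly_null_near x (f : {scalar E}) (e : R) : weakly_null x ->
  continuous f -> 0 < e -> \forall n \near \oo, `|f (x n)| <= e.
Proof.
move=> wx fc e0; have /cvgr0Pnorm_le := wx f fc; exact.
Qed.

(** Mazur's theorem, for combinations that are not normalized.  If it fails, the
    infimum of |v + sum a_n x_n| - d sum a_n over nonnegative a is sublinear in
    v, at most |v|, and at most - d at - x_n: a linear functional below it is
    bounded and at least d at all the x_n. *)
Lemma weakly_null_combination x (d : R) : weakly_null x -> 0 < d ->
  exists2 s : seq (nat * R), (forall c, c \in s -> 0 <= c.2) &
    `|\sum_(c <- s) c.2 *: x c.1| < d * \sum_(c <- s) c.2.
Proof.
move=> wx d0; apply: contrapT => H.
have h (s : seq (nat * R)) : (forall c, c \in s -> 0 <= c.2) ->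
    d * \sum_(c <- s) c.2 <= `|\sum_(c <- s) c.2 *: x c.1|.
  by move=> s0; rewrite leNgt; apply/negP => lt; apply: H; exists s.
pose S (v : E) := [set `|v + \sum_(c <- s) c.2 *: x c.1| - d * \sum_(c <- s) c.2 |
  s in [set s : seq (nat * R) | forall c, c \in s -> 0 <= c.2]].
have Slb v : lbound (S v) (- `|v|).
  move=> _ [s s0 <-]; rewrite lerBrDr -lerBrDl opprK (le_trans (h s s0))//.
  by rewrite -[X in `|X| <= _](addKr v) addrC (le_trans (ler_normD _ _))// normrN.
have Snil v : S v `|v| by exists [::] => //=; rewrite !big_nil addr0 mulr0 subr0.
have sp : sublinear (fun v => inf (S v)).
  apply: sublinear_inf.
  - by move=> v; exists `|v|.
  - by move=> v; exists (- `|v|).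
  - by have := Slb 0; rewrite normr0 oppr0.
  - move=> v w _ _ [s s0 <-] [t t0 <-]; eexists.
      exists (s ++ t) => //= c; rewrite mem_cat => /orP[]; [exact: s0|exact: t0].
    rewrite !big_cat/= addrACA mulrDr opprD [leRHS]addrACA.
    by rewrite lerD2r ler_normD.
  - move=> a v _ a0 [s s0 <-]; eexists.
      exists [seq (c.1, a * c.2) | c <- s] => //= _ /mapP[c cs ->] /=.
      by rewrite mulr_ge0 ?s0// ltW.
    rewrite !big_map/=.
    under eq_bigr do rewrite -scalerA.
    by rewrite -scaler_sumr -scalerDr -mulr_sumr normrZ gtr0_norm// mulrBr mulrCA.
  - by rewrite -[X in S _ X](@normr0 _ E).
have [f [fp _]] := hahn_banach 0 sp.
have fn v : f v <= `|v|.
  rewrite (le_trans (fp v))//; apply: ge_inf => //; by exists (- `|v|).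
have fc : continuous f.
  by apply: (seminorm_dominated_continuous (seminorm_norm E) fn (C := 1)) => v;
    rewrite mul1r.
have fx n : d <= f (x n).
  rewrite -lerN2 -raddfN (le_trans (fp _))// ge_inf//; first by exists (- `|- x n|).
  exists [:: (n, 1)] => [c|]; first by rewrite inE => /eqP ->; exact: ler01.
  by rewrite !big_seq1 scale1r addNr normr0 mulr1 sub0r.
have [N _ /(_ N (leqnn N))] := weakly_null_near wx fc (divr_gt0 d0 (ltr0n R 2)).
rewrite leNgt => /negP; apply; rewrite (lt_le_trans _ (ler_norm _))//.
by rewrite (lt_le_trans _ (fx N))// ltr_pdivrMr// ltr_pMr// ltr1n.
Qed.

(** The gliding hump argument.  If the seminorms q_i are summable, uniformly on
    bounded sets, then q_i (y_i) tends to 0 along a weakly null sequence y: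
    after passing to a subsequence, functionals supporting q_i at y_i are
    almost biorthogonal to y, so that the convex combinations of y stay away
    from 0. *)
Lemma gliding_hump y (q : nat -> E -> R) (C eps : R) :
  weakly_null y -> (forall i, seminorm (q i)) ->
  (forall N v, \sum_(i < N) q i v <= C * `|v|) ->
  0 < eps -> ~ (forall i, eps <= q i (y i)).
Proof.
move=> wy sq qC eps0 qy.
have q0 i v : 0 <= q i v by exact: seminorm_ge0.
have /choice[g gP] : forall i, exists g : {scalar E},
    (forall v, g v <= q i v) /\ g (y i) = q i (y i).
  by move=> i; exact/hahn_banach/seminorm_sublinear.
have gq i v : `|g i v| <= q i v.
  by apply: scalar_le_seminorm => // w; exact: (gP i).1.
have qiC i v : q i v <= C * `|v|.
  by rewrite (le_trans _ (qC i.+1 v))// big_ord_recr/= lerDr sumr_ge0.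
have gc i : continuous (g i).
  exact: (seminorm_dominated_continuous (sq i) (gP i).1 (qiC i)).
have q_cvg v : (fun i => q i v) @ \oo --> (0 : R).
  apply: cvg_series_cvg_0; apply: nondecreasing_is_cvgn.
    apply/nondecreasing_seqP => n; rewrite /series/= !big_mkord big_ord_recr/=.
    by rewrite lerDl.
  by exists (C * `|v|) => _ [n _ <-]; rewrite /series/= big_mkord.
pose r k := eps / 8 * 2^-1 ^+ k.
have r0 k : 0 < r k by rewrite mulr_gt0 ?divr_gt0 ?exprn_gt0 ?invr_gt0.
have [|phi hphi Pphi] := @fast_subseq (fun s n => forall j, j \in s ->
    `|g j (y n)| <= r (size s) /\ q n (y j) <= r (size s)) _.
  move=> s; elim: s (size s) => [|j s ih] m; first exact: nearW.
  near=> n => i; rewrite inE => /predU1P[->|]; last first.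
    by move: i; near: n; exact: ih.
  split; first by near: n; exact: weakly_null_near.
  near: n; have /cvgr0Pnorm_le/(_ _ (r0 m)) := q_cvg (y j).
  by apply: filterS => n; rewrite ger0_norm.
have small i j : i != j -> `|g (phi i) (y (phi j))| <= r i.
  have inm a b : (a < b)%N -> phi a \in mkseq phi b.
    by move=> ab; apply: map_f; rewrite mem_iota.
  rewrite neq_ltn => /orP[ij|ji].
    have [+ _] := Pphi j _ (inm _ _ ij); rewrite size_mkseq => /le_trans; apply.
    rewrite ler_pM2l ?divr_gt0//; apply: ler_wiXn2l;
      rewrite ?invr_ge0 ?invf_le1 ?ler1n//.
    exact: ltnW.
  have [_] := Pphi i _ (inm _ _ ji); rewrite size_mkseq.
  exact/le_trans/gq.
have sumr N : \sum_(i < N) r i <= eps / 4.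
  rewrite -mulr_sumr (le_trans (ler_wpM2l _ (sum_half_le R N))) ?divr_ge0 ?(ltW eps0)//.
  by lra.
have diag N (j : 'I_N) : eps * 3 / 4 <= \sum_(i < N) g (phi i) (y (phi j)).
  rewrite (bigD1 j)//= (gP _).2.
  have : - (eps / 4) <= \sum_(i < N | i != j) g (phi i) (y (phi j)).
    rewrite lerNl -sumrN (le_trans _ (sumr N))//.
    rewrite [leRHS](bigD1 j)//= ler_wpDl ?(ltW (r0 _))//.
    apply: ler_sum => i ij; rewrite (le_trans (ler_norm _))// normrN.
    by apply: small; rewrite (inj_eq val_inj).
  by have := qy (phi j); lra.
pose d := eps / (2 * (`|C| + 1)).
have C1 : 0 < `|C| + 1 by rewrite ltr_wpDl.
have d0 : 0 < d by rewrite divr_gt0// mulr_gt0.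
have [s s0 hs] := weakly_null_combination (weakly_null_subseq hphi wy) d0.
set v := \sum_(c <- s) _ in hs; set t := \sum_(c <- s) c.2 in hs.
have t0 : 0 < t by rewrite -(pmulr_rgt0 _ d0) (le_lt_trans _ hs).
pose N := (\max_(c <- s) c.1).+1.
have sN c : c \in s -> (c.1 < N)%N.
  by move=> cs; rewrite ltnS;
    exact: (@leq_bigmax_seq _ s xpredT (fun c : nat * R => c.1)).
have : eps * 3 / 4 * t <= C * `|v|.
  rewrite (le_trans _ (qC (phi N) v))//.
  rewrite (le_trans _ (@sum_subseq_le _ (fun i => q i v) _ _ _ _))//.
  apply: (@le_trans _ _ (\sum_(i < N) g (phi i) v)); last first.
    by apply: ler_sum => i _; exact: (gP _).1.
  under eq_bigr do rewrite raddf_sum.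
  rewrite exchange_big/= /t mulr_sumr big_seq [leRHS]big_seq.
  apply: ler_sum => c cs.
  under eq_bigr do rewrite linearZ/=.
  rewrite -mulr_sumr mulrC ler_wpM2l ?s0//.
  exact: (diag N (Ordinal (sN _ cs))).
apply/negP; rewrite -ltNge.
apply: (@le_lt_trans _ _ ((`|C| + 1) * `|v|)).
  by rewrite ler_wpM2r// (le_trans (ler_norm _))// lerDl.
apply: (@lt_le_trans _ _ ((`|C| + 1) * (d * t))); first by rewrite ltr_pM2l.
have -> : (`|C| + 1) * (d * t) = eps / 2 * t by rewrite /d; field; rewrite gt_eqF.
by rewrite ler_pM2r//; lra.
Unshelve. all: by end_near. Qed.

(** The uniform boundedness principle, by the gliding hump argument for
    q_i = 2^-i |.|. *)
Lemma weakly_null_bounded x : weakly_null x ->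
  exists M : R, forall n, `|x n| <= M.
Proof.
move=> wx; apply: contrapT => H.
have [|phi hphi Pphi] := @frequent_subseq (fun k n => 2 ^+ k <= `|x n|) _.
  move=> k N; apply: contrapT => h; apply: H.
  exists (2 ^+ k + \sum_(i < N) `|x i|) => n; have [nN|Nn] := ltnP n N.
    rewrite (bigD1 (Ordinal nN))//= addrCA lerDl addr_ge0 ?exprn_ge0//.
    exact: sumr_ge0.
  rewrite ler_wpDr ?sumr_ge0// leNgt; apply/negP => lt; apply: h.
  by exists n => //; exact: ltW.
apply: (@gliding_hump (x \o phi) (fun i v => 2^-1 ^+ i * `|v|) 2 1) => //.
- exact: weakly_null_subseq.
- move=> i; split=> [v w|t v]; last by rewrite normrZ mulrCA.
  by rewrite -mulrDr ler_wpM2l ?exprn_ge0 ?invr_ge0 ?ler_normD.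
- move=> N v; rewrite -mulr_suml ler_wpM2r//.
  exact: sum_half_le.
- by move=> i; rewrite exprVn mulrC ler_pdivlMr ?mul1r ?exprn_gt0.
Qed.

End WeaklyNull.

(** * Ramsey's theorem *)

(** Iterated extraction: [Theta k.+1] is a subsequence of [Theta k] chosen by Q,
    and all the later terms of the diagonal [Theta ^~ 0] lie in the range of
    [Theta k]. *)
Lemma diagonal_subseq (Q : nat -> (nat -> nat) -> (nat -> nat) -> Prop) :
  (forall k theta, increasing_seq theta ->
    exists2 chi, increasing_seq chi & Q k theta (theta \o S \o chi)) ->
  exists Theta : nat -> nat -> nat,
    [/\ forall k, increasing_seq (Theta k),
        forall k, Q k (Theta k) (Theta k.+1),
        increasing_seq (Theta ^~ 0%N) &
        forall k j, (k <= j)%N -> exists t, Theta j 0%N = Theta k t].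
Proof.
move=> h.
have /choice[f fP] : forall c : nat * (nat -> nat), exists chi : nat -> nat,
    increasing_seq c.2 -> increasing_seq chi /\ Q c.1 c.2 (c.2 \o S \o chi).
  move=> [k theta]; have [it|nit] := pselect (increasing_seq theta).
    by have [chi ichi Qchi] := h k _ it; exists chi.
  by exists id => /nit.
pose Theta := fix Theta k := if k is k'.+1
  then Theta k' \o S \o f (k', Theta k') else id.
have iS : increasing_seq S by [].
have iT k : increasing_seq (Theta k).
  elim: k => [//|k ih] /=; have [ichi _] := fP (k, Theta k) ih.
  by apply: increasing_seq_comp => //; exact: increasing_seq_comp.
have sub k j : exists sigma : nat -> nat, Theta (k + j)%N = Theta k \o sigma.
  elim: j => [|j [sigma e]]; first by exists id; rewrite addn0.
  by exists (sigma \o S \o f ((k + j)%N, Theta (k + j)%N)); rewrite addnS /= e.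
exists Theta; split=> //.
- by move=> k; exact: (fP (k, Theta k) (iT k)).2.
- apply/increasing_seqP => k /=.
  have /increasing_seqP h0 := iT k; apply: lt_le_trans (h0 0%N) _.
  by rewrite (iT k).
- move=> k j kj; have [sigma] := sub k (j - k)%N.
  by rewrite subnKC// => ->; exists (sigma 0%N).
Qed.

Lemma increasing_seq_sorted (theta : nat -> nat) s : increasing_seq theta ->
  sorted ltn (map theta s) = sorted ltn s.
Proof.
move=> it; rewrite sorted_map; apply: eq_sorted => i j /=.
by rewrite -[LHS]/(theta i < theta j)%O (leW_mono it).
Qed.

Lemma sorted_preimage (delta theta : nat -> nat) s : increasing_seq delta ->
  increasing_seq theta -> (forall j, j \in s -> exists t, delta j = theta t) ->
  sorted ltn s ->
  exists ts, [/\ sorted ltn ts, size ts = size s & map delta s = map theta ts].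
Proof.
move=> idelta it h ss.
suff [ts e1 e2] : exists2 ts, size ts = size s & map delta s = map theta ts.
  exists ts; split=> //.
  by rewrite -(increasing_seq_sorted ts it) -e2 (increasing_seq_sorted s idelta).
elim: s h {ss} => [|j s ih] h; first by exists [::].
have [|ts e1 e2] := ih; first by move=> i si; apply: h; rewrite inE si orbT.
have [|t e] := h j; first by rewrite mem_head.
by exists (t :: ts); rewrite /= ?e1// e e2.
Qed.

(** Ramsey's infinite theorem for two colours; an m-set of indices is a strictly
    increasing list of length m, and C is the set of the lists of one colour. *)
Theorem ramsey m (C : seq nat -> Prop) :
  exists2 psi, increasing_seq psi &
    (forall s, sorted ltn s -> size s = m -> C (map psi s)) \/
    (forall s, sorted ltn s -> size s = m -> ~ C (map psi s)).
Proof.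
elim: m C => [|m ih] C.
  exists id => //; have [C0|C0] := pselect (C [::]).
    by left=> s _ /size0nil ->.
  by right=> s _ /size0nil ->.
(* All the (m + 1)-sets with first element a and other elements in the range
   of theta have the same colour. *)
pose B (a : nat) (theta : nat -> nat) :=
  forall s, sorted ltn s -> size s = m -> C (a :: map theta s).
pose B' (a : nat) (theta : nat -> nat) :=
  forall s, sorted ltn s -> size s = m -> ~ C (a :: map theta s).
have [|Theta [iT QT idelta sub]] := @diagonal_subseq
    (fun _ theta theta' => B (theta 0%N) theta' \/ B' (theta 0%N) theta').
  move=> _ theta it.
  have [chi ichi h] := ih (fun s => C (theta 0%N :: map (theta \o S) s)).
  exists chi => //; case: h => h; [left|right] => s ss sm.
  - by have := h s ss sm; rewrite -map_comp.
  - by have := h s ss sm; rewrite -map_comp.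
pose delta k := Theta k 0%N.
have pre k s : sorted ltn (k :: s) -> exists ts,
    [/\ sorted ltn ts, size ts = size s & map delta s = map (Theta k.+1) ts].
  move=> ss; apply: sorted_preimage => //; last exact: path_sorted ss.
  move=> j js; apply: sub.
  by have /allP := order_path_min ltn_trans ss; exact.
have hom psi (P : seq nat -> Prop) : increasing_seq psi ->
    (forall k s, sorted ltn s -> size s = m ->
      P (delta (psi k) :: map (Theta (psi k).+1) s)) ->
    forall s, sorted ltn s -> size s = m.+1 -> P (map (delta \o psi) s).
  move=> ipsi h [//|k s] ss [sm].
  have [|ts [sts sizts ets]] := pre (psi k) (map psi s).
    by rewrite -[_ :: _]/(map psi (k :: s)) increasing_seq_sorted.
  rewrite /= map_comp ets; apply: h => //.
  by rewrite sizts size_map.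
have [nB|] := pselect (\forall k \near \oo, B' (delta k) (Theta k.+1)).
  have [N _ NB] := nB.
  have iN := increasing_seq_addn N.
  exists (delta \o addn N); first exact: increasing_seq_comp.
  right; apply: (hom _ (fun s => ~ C s)) => // k s ss sm.
  by apply: NB => //=; exact: leq_addr.
move=> /not_near_subseq[rho irho nB'].
exists (delta \o rho); first exact: increasing_seq_comp.
left; apply: hom => // k s ss sm.
by case: (QT (rho k)) => [|/nB'//]; exact.
Qed.

(** * Hereditarily Cesàro null subsequences *)

Section HereditaryCesaro.
Context (R : realType) (E : banachLatticeType R) (p : E -> R).
Hypothesis sp : seminorm p.

(* A block of length n is cut into blocks of length m and a remainder. *)
Let block_bound (z : nat -> E) (M eta : R) m : (0 < m)%N ->
  (forall i, p (z i) <= M) ->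
  (forall a, p (\sum_(i <- iota a m) z i) <= eta * m%:R) -> 0 <= eta ->
  forall n a, p (\sum_(i <- iota a n) z i) <= eta * n%:R + m%:R * M.
Proof.
move=> m0 zM h eta0; have M0 : 0 <= M by rewrite (le_trans _ (zM 0%N))// seminorm_ge0.
elim/ltn_ind => n ih a; have [nm|mn] := ltnP n m.
  apply: (@le_trans _ _ (n%:R * M)).
    rewrite (le_trans (seminorm_sum _ _ _ sp))//.
    rewrite (le_trans (ler_sum _ (fun i _ => zM i)))//.
    by rewrite big_const_seq count_predT size_iota iter_addr_0 mulr_natl.
  by rewrite ler_wpDl ?mulr_ge0// ler_wpM2r// ler_nat ltnW.
rewrite -(subnKC mn) iotaD big_cat/= (le_trans (sp.1 _ _))//.
rewrite natrD mulrDr -addrA lerD//; apply: ih.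
by rewrite ltn_subrL m0 (leq_trans m0).
Qed.

(* Otherwise Ramsey's theorem yields, for each m > 0, a subsequence all of whose
   m-sets have average at least eps, and the diagonal subsequence contradicts
   the hypothesis, which provides an m-set of indices larger than m. *)
Let one_level (y : nat -> E) (eps : R) psi : 0 < eps -> increasing_seq psi ->
  (forall theta, increasing_seq theta ->
    exists m s, [/\ (0 < m)%N, sorted ltn s, size s = m, all (ltn m) s &
      p (\sum_(i <- s) y (psi (theta i))) < eps * m%:R]) ->
  exists2 m, (0 < m)%N & exists2 chi, increasing_seq chi &
    forall s, sorted ltn s -> size s = m ->
      p (\sum_(i <- map chi s) y (psi i)) < eps * m%:R.
Proof.
move=> eps0 ipsi hyp; apply: contrapT => H.
have [|Theta [iT QT idelta sub]] := @diagonal_subseq (fun m _ theta =>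
    (0 < m)%N -> forall s, sorted ltn s -> size s = m ->
      ~ p (\sum_(i <- map theta s) y (psi i)) < eps * m%:R).
  move=> m theta it; have [->|m0] := posnP m; first by exists id.
  have [chi ichi h] := ramsey m (fun s =>
    p (\sum_(i <- map (theta \o S) s) y (psi i)) < eps * m%:R).
  exists chi => // _ s ss sm; case: h => h; last first.
    by have := h s ss sm; rewrite -map_comp.
  exfalso; apply: H; exists m => //; exists (theta \o S \o chi).
    by apply: increasing_seq_comp => //; exact: increasing_seq_comp.
  by move=> t st tm; have := h t st tm; rewrite -map_comp.
have [m [s [m0 ss sm am]]] := hyp _ idelta.
have [|ts [sts tsm e]] := sorted_preimage idelta (iT m.+1) _ ss.
  by move=> j /(allP am) mj; exact: sub.
rewrite -(big_map (Theta ^~ 0%N) xpredT (fun i => y (psi i))) e.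
by apply: (QT m) => //; rewrite tsm.
Qed.

(** If every subsequence of a p-bounded sequence y contains, arbitrarily far,
    finite sets with small average, then some subsequence of y has all its
    subsequences Cesàro null for p. *)
Lemma hereditary_cesaro_null (y : nat -> E) (M : R) : (forall i, p (y i) <= M) ->
  (forall (eps : R) psi, 0 < eps -> increasing_seq psi ->
    exists m s, [/\ (0 < m)%N, sorted ltn s, size s = m, all (ltn m) s &
      p (\sum_(i <- s) y (psi i)) < eps * m%:R]) ->
  exists2 psi, increasing_seq psi & forall chi, increasing_seq chi ->
    (fun n => p (cesaro_seq (y \o psi \o chi) n)) @ \oo --> (0 : R).
Proof.
move=> yM hyp.
have M0 : 0 <= M by rewrite (le_trans _ (yM 0%N))// seminorm_ge0.
have iS : increasing_seq S by [].
have [|Theta [iT QT idelta sub]] := @diagonal_subseq (fun k _ theta =>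
    exists2 m, (0 < m)%N & forall s, sorted ltn s -> size s = m ->
      p (\sum_(i <- map theta s) y i) < k.+1%:R^-1 * m%:R).
  move=> k theta it.
  have its : increasing_seq (theta \o S) by exact: increasing_seq_comp.
  have k0 : 0 < k.+1%:R^-1 :> R by rewrite invr_gt0.
  have [|m m0 [chi ichi h]] := @one_level y _ _ k0 its.
    move=> rho irho; apply: (hyp _ (theta \o S \o rho)) => //.
    exact: increasing_seq_comp.
  exists chi => //; exists m => // s ss sm.
  by rewrite map_comp big_map; exact: h.
exists (Theta ^~ 0%N) => // chi ichi.
set delta := Theta ^~ 0%N in idelta *.
apply/cvgr0Pnorm_le => e e0.
have [k hk] : exists k : nat, k.+1%:R^-1 <= e / 2.
  exists (Num.truncn (e / 2)^-1); rewrite invf_ple ?posrE ?divr_gt0//.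
  by rewrite ltW// truncnS_gt// invr_ge0 divr_ge0// ltW.
have [m m0 hm] := QT k.
pose z i := y (delta (chi (k.+1 + i)%N)).
have ik := increasing_seq_addn k.+1.
have ichik : increasing_seq (chi \o addn k.+1) by exact: increasing_seq_comp.
have zb a : p (\sum_(i <- iota a m) z i) <= e / 2 * m%:R.
  have [||||ts [sts tsm et]] := @sorted_preimage (delta \o (chi \o addn k.+1))
      (Theta k.+1) (iota a m).
  - exact: increasing_seq_comp.
  - by [].
  - move=> j _; apply: sub => /=.
    by rewrite (leq_trans _ (increasing_seq_ge ichi _))// leq_addr.
  - exact: iota_ltn_sorted.
  rewrite -(big_map (delta \o (chi \o addn k.+1)) xpredT y) et.
  rewrite (le_trans (ltW (hm _ sts _)))// ?tsm ?size_iota//.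
  by rewrite ler_wpM2r.
have bound n : p (\sum_(i <- iota 0 (k.+1 + n)) y (delta (chi i))) <=
    (k.+1 + m)%:R * M + e / 2 * n%:R.
  rewrite iotaD big_cat/= (le_trans (sp.1 _ _))// natrD mulrDl -addrA lerD//.
    rewrite (le_trans (seminorm_sum _ _ _ sp))//.
    rewrite (le_trans (ler_sum _ (fun i _ => yM _)))//.
    by rewrite big_const_seq count_predT /= size_iota -iterS iter_addr_0 mulr_natl.
  have -> : \sum_(i <- iota (0 + k.+1) n) y (delta (chi i)) =
      \sum_(i <- iota 0 n) z i.
    by rewrite -[(0 + _)%N]addn0 iotaDl big_map.
  rewrite addrC; apply: (@block_bound z M _ m) => //; first by move=> i; exact: yM.
  by rewrite divr_ge0// ltW.
near=> n; rewrite ger0_norm ?seminorm_ge0// /cesaro_seq sp.2.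
rewrite ger0_norm ?invr_ge0// mulrC ler_pdivrMr//.
have kn : (k.+1 <= n.+1)%N by near: n; exists k.
rewrite /series/= /index_iota subn0 -{1}(subnKC kn) (le_trans (bound _))//.
rewrite [leRHS](_ : _ = e / 2 * n.+1%:R + e / 2 * n.+1%:R); last by field.
apply: lerD; last by rewrite ler_wpM2l ?divr_ge0 ?(ltW e0)// ler_nat leq_subr.
rewrite [leRHS]mulrC -ler_pdivrMr ?divr_gt0//; apply: (@le_trans _ _ n%:R);
  last by rewrite ler_nat.
near: n; exact: nbhs_infty_ger.
Unshelve. all: by end_near. Qed.

End HereditaryCesaro.

(** * Order continuous norms *)

Section MonotoneSequences.
Context (R : realType) (E : banachLatticeType R).
Implicit Types (z : nat -> E) (u : E).

Lemma bl_nondecreasing z : (forall n, z n <= z n.+1) ->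
  forall m n, (m <= n)%N -> z m <= z n.
Proof. move=> h m n; elim: n => [|n ih]; first by rewrite leqn0 => /eqP ->.
by rewrite leq_eqVlt ltnS => /predU1P[->//|/ih zmn]; exact: le_trans zmn (h n). Qed.

Lemma bl_cvg_ub z (l : E) : (forall n, z n <= z n.+1) -> z @ \oo --> l ->
  forall n, z n <= l.
Proof.
move=> h zl n; apply: (cvg_bl_le (@cvg_cst _ (z n) _ \oo _) zl).
by exists n => // m /= nm; exact: bl_nondecreasing.
Qed.

(** In an order continuous Banach lattice, bounded increasing sequences converge
    in norm: the differences v - z_n, with v an upper bound, decrease to 0. *)
Lemma order_continuous_cvgn z u : order_continuous E ->
  (forall n, z n <= z n.+1) -> (forall n, z n <= u) -> cvgn z.
Proof.
move=> hE zS zu; have zle := bl_nondecreasing zS.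
pose I := ({v : E | forall n, z n <= v} * nat)%type.
pose r (i j : I) := sval j.1 <= sval i.1 /\ (i.2 <= j.2)%N.
pose y (i : I) := sval i.1 - z i.2.
have y0 i : 0 <= y i by rewrite bl_subr_ge0; exact: (svalP i.1).
have rdir : directed r.
  split=> [|i|i j k [ij ij'] [jk jk']|i j].
  - exact: inhabits (exist _ u zu, 0%N).
  - by [].
  - by split; [exact: le_trans jk ij|exact: leq_trans ij' jk'].
  - have h n : z n <= Order.meet (sval i.1) (sval j.1).
      by rewrite lexI (svalP i.1) (svalP j.1).
    exists (exist _ _ h, maxn i.2 j.2); split; split => /=.
    + exact: leIl.
    + exact: leq_maxl.
    + exact: leIr.
    + exact: leq_maxr.
have ydec i j : r i j -> y j <= y i.
  by move=> [h1 h2]; rewrite bl_lerD// bl_lerN2 zle.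
have yinf : infimums (range y) 0.
  split=> [_ [i _ <-]//|w wy].
  have step v : (forall n, z n <= v) -> forall n, z n <= v - w.
    move=> vz n; rewrite bl_lerBrDr addrC -bl_lerBrDr.
    by apply: wy; exists (exist _ v vz, n).
  apply: (@bl_archimedean _ _ _ (u - z 0%N)) => k.
  suff : forall n, z n <= u - k%:R *: w.
    by move=> /(_ 0%N); rewrite bl_lerBrDr addrC -bl_lerBrDr.
  elim: k => [|k ih]; first by rewrite scale0r subr0.
  rewrite -natr1 scalerDl scale1r opprD addrA; exact: step.
apply/cauchy_cvgP/cauchy_exP => e e0.
have [i0 h0] := hE I r y (And3 rdir ydec yinf) e e0.
have [_ rr _ _] := rdir.
have := h0 i0 (rr i0); rewrite /y; case: i0 {h0} => [[v vz] N] /= h.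
exists (z N); exists N => // n /= Nn.
rewrite -ball_normE /ball_/= distrC (le_lt_trans _ h)// bl_norm_le_pos//.
  by rewrite bl_subr_ge0 zle.
by rewrite bl_lerD2r.
Qed.

(** The suprema W_n of z_k over k >= n, as norm limits of finite suprema. *)
Lemma tail_suprema z u : order_continuous E ->
  (forall k, 0 <= z k) -> (forall k, z k <= u) ->
  exists W : nat -> E, [/\ forall n, z n <= W n, forall n, W n.+1 <= W n &
    forall n, exists2 V : nat -> E, V @ \oo --> W n &
      forall N, [/\ 0 <= V N, V N <= W n & V N <= \sum_(k < N) z (n + k)%N]].
Proof.
move=> hE z0 zu.
pose V n := fix V (N : nat) : E := if N is N'.+1 then Order.join (V N') (z (n +
  N')%N) else 0.
have u0 : 0 <= u by exact: le_trans (z0 0%N) (zu 0%N).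
have VS n N : V n N <= V n N.+1 by exact: leUl.
have Vu n N : V n N <= u by elim: N => //= N ih; rewrite leUx ih zu.
have V0 n N : 0 <= V n N by elim: N => //= N ih; exact: le_trans ih (leUl _ _).
have Vc n : cvgn (V n) by exact: order_continuous_cvgn hE (VS n) (Vu n).
have VW n N : V n N <= limn (V n) by exact: bl_cvg_ub (VS n) (Vc n) N.
exists (fun n => limn (V n)); split=> [n|n|n].
- by rewrite (le_trans _ (VW n 1%N))//= addn0; exact: leUr.
- have h N : V n.+1 N <= V n N.+1.
    elim: N => [|N ih]; first exact: V0.
    change (Order.join (V n.+1 N) (z (n.+1 + N)%N) <=
            Order.join (V n N.+1) (z (n + N.+1)%N)).
    by rewrite addnS addSn leU2.
  apply: (cvg_bl_le (Vc n.+1) (@cvg_cst _ (limn (V n)) _ \oo _)).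
  by apply: nearW => N; exact: le_trans (h N) (VW n N.+1).
- exists (V n) => // N; split=> //.
  elim: N => [|N ih]; first by rewrite big_ord0.
  rewrite big_ord_recr/= leUx; apply/andP; split.
    by rewrite (le_trans ih)// bl_lerDl.
  by rewrite addrC bl_lerDl// bl_sumr_ge0.
Qed.

(** A sequence of positive elements bounded in norm is dominated, up to
    constants, by a single element. *)
Lemma weighted_dominant z (M : R) : (forall n, 0 <= z n) ->
  (forall n, `|z n| <= M) ->
  exists2 u : E, 0 <= u & forall n, z n <= 2 ^+ n *: u.
Proof.
move=> z0 zM; pose w n := 2^-1 ^+ n *: z n.
have w0 n : 0 <= w n by rewrite bl_scaler_ge0// exprn_ge0// invr_ge0.
have wc : cvgn (series w).
  apply: normed_cvg; apply: (@series_le_cvg _ _ (geometric `|M| 2^-1)).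
  - by move=> n; exact: normr_ge0.
  - by move=> n; rewrite /= mulr_ge0// exprn_ge0// invr_ge0.
  - move=> n /=; rewrite normrZ ger0_norm ?exprn_ge0 ?invr_ge0// mulrC.
    rewrite ler_wpM2r ?exprn_ge0 ?invr_ge0//.
    by rewrite (le_trans (zM n))// ler_norm.
  - by apply: is_cvg_geometric_series; rewrite ger0_norm ?invr_ge0// invf_lt1 ?ltr1n.
have wS n : series w n <= series w n.+1.
  by rewrite /series/= big_nat_recr//= bl_lerDl.
have wub := bl_cvg_ub wS wc.
exists (limn (series w)) => [|n].
  by have := wub 0%N; rewrite /series/= big_geq.
have wn : w n <= limn (series w).
  rewrite (le_trans _ (wub n.+1))// /series/= big_nat_recr//= addrC bl_lerDl//.
  exact: bl_sumr_ge0.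
have -> : z n = 2 ^+ n *: w n.
  by rewrite /w scalerA exprVn divff ?scale1r// expf_eq0 pnatr_eq0 andbF.
by rewrite bl_ler_wpZ2l ?exprn_ge0.
Qed.

End MonotoneSequences.

(** * Disjoint weakly null sequences *)

Section DisjointWeaklyNull.
Context (R : realType) (E : banachLatticeType R).
Implicit Types (x : nat -> E).

Lemma disjoint_seq_opp x : disjoint_seq x -> disjoint_seq (fun n => - x n).
Proof. by move=> h m n mn; rewrite !modulusN h. Qed.

Lemma weakly_null_opp x : weakly_null x -> weakly_null (fun n => - x n).
Proof.
move=> wx f fc; rewrite -[0 : R]oppr0.
rewrite (_ : _ \o _ = (fun n => - f (x n))); last by apply/funext => n /=;
  rewrite raddfN.
by apply: cvgN; exact: wx.
Qed.

(** For nonnegative a_n, the elements sum a_n x_n^+ and sum a_n x_n^- are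
    disjoint, so the modulus of sum a_n x_n dominates the former. *)
Lemma disjoint_seq_norm_pospart x (s : seq (nat * R)) : disjoint_seq x ->
  (forall c, c \in s -> 0 <= c.2) ->
  `|\sum_(c <- s) c.2 *: pospart (x c.1)| <= `|\sum_(c <- s) c.2 *: x c.1|.
Proof.
move=> dx s0.
have xm m n : Order.meet (pospart (x m)) (pospart (- x n)) = 0.
  have [->|mn] := eqVneq m n; first exact: pospart_meet0.
  apply: meet0_le (dx n m _); rewrite ?pospart_ge0 1?eq_sym//.
    exact: pospart_le_modulus.
  by rewrite -modulusN pospart_le_modulus.
have p0 m (c : nat * R) : c \in s -> 0 <= c.2 *: pospart (x c.1) /\
    Order.meet (c.2 *: pospart (x c.1)) (pospart (- x m)) = 0.
  by move=> /s0 c0; split; [rewrite bl_scaler_ge0 ?pospart_ge0|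
    rewrite meet0Z ?pospart_ge0].
have [X0 _] := meet0_sum (pospart_ge0 (- x 0%N)) (fun c cs (_ : true) => p0 0%N c cs).
set X := \sum_(c <- s) _ in X0 *; pose Y := \sum_(c <- s) c.2 *: pospart (- x c.1).
have [Y0 XY] : 0 <= Y /\ Order.meet Y X = 0.
  apply: meet0_sum => // c cs _; split; first by rewrite bl_scaler_ge0 ?pospart_ge0 ?s0.
  rewrite meet0Z ?pospart_ge0 ?s0// meetC.
  by apply: (meet0_sum _ _).2 => [|d ds _]; [exact: pospart_ge0|exact: p0].
have -> : \sum_(c <- s) c.2 *: x c.1 = X - Y.
  rewrite -sumrB; apply: eq_bigr => c _.
  by rewrite -scalerBr pospartB.
rewrite -(norm_modulus (X - Y)) modulus_meet0 1?meetC// bl_norm_le_pos//.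
exact: bl_lerDl.
Qed.

(** The positive parts of a disjoint weakly null sequence are weakly null: a
    functional bounded below by e > 0 on the x_n^+ would bound the norm of convex
    combinations of the x_n from below. *)
Lemma weakly_null_pospart x : disjoint_seq x -> weakly_null x ->
  weakly_null (fun n => pospart (x n)).
Proof.
move=> dx wx f fc.
have lt (g : {scalar E}) (e : R) : continuous g -> 0 < e ->
    \forall n \near \oo, g (pospart (x n)) < e.
  move=> gc e0; apply: contrapT => /not_near_subseq[phi hphi ge].
  have [M M0 gM] := continuous_scalar_bounded gc.
  have [s s0] := weakly_null_combination (weakly_null_subseq hphi wx) (divr_gt0 e0 M0).
  have dxphi : disjoint_seq (x \o phi).
    by move=> m n mn; apply: dx; rewrite (inj_eq (increasing_seq_injective hphi)).
  move=> /(le_lt_trans (disjoint_seq_norm_pospart dxphi s0)).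
  rewrite mulrAC ltr_pdivlMr// mulrC => /(le_lt_trans (gM _)).
  move=> /(le_lt_trans (ler_norm _)); rewrite raddf_sum/= ltNge => /negP; apply.
  rewrite mulr_sumr big_seq [leRHS]big_seq; apply: ler_sum => c cs.
  by rewrite linearZ/= mulrC ler_wpM2l ?s0// leNgt; apply/negP; exact: ge.
apply/cvgr0Pnorm_lt => e e0.
pose g : {scalar E} := \- f.
have gc : continuous g by move=> v; apply: cvgN; exact: fc.
near=> n; rewrite /= ltr_norml ltrNl; apply/andP; split.
- by near: n; apply: (lt g).
- by near: n; apply: (lt f).
Unshelve. all: by end_near. Qed.

End DisjointWeaklyNull.

(** * Positive functionals *)

Section PositiveFunctionals.
Context (R : realType) (E : banachLatticeType R).
Implicit Types (f : E -> R) (x y z u : E).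

(** Bounded positive linear functionals. *)
Definition positive_functional f := [/\ scalar f, forall x, 0 <= x -> 0 <= f x &
  exists M : R, forall x, `|f x| <= M * `|x|].

Lemma positive_functional_scalar f : positive_functional f ->
  exists2 g : {scalar E}, continuous g & g =1 f.
Proof.
move=> [fl _ [M fM]].
pose g : {scalar E} := HB.pack f (GRing.isLinear.Build R E R *%R f fl).
by exists g => //; exact: (@bounded_scalar_continuous _ _ g M).
Qed.

Lemma posfunD f x y : positive_functional f -> f (x + y) = f x + f y.
Proof.
by move=> /positive_functional_scalar[g _ e]; rewrite -!e raddfD.
Qed.

Lemma posfunZ f (a : R) x : positive_functional f -> f (a *: x) = a * f x.
Proof.
by move=> /positive_functional_scalar[g _ e]; rewrite -!e linearZ.
Qed.

Lemma posfunB f x y : positive_functional f -> f (x - y) = f x - f y.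
Proof.
by move=> /positive_functional_scalar[g _ e]; rewrite -!e raddfB.
Qed.

Lemma posfun0 f : positive_functional f -> f 0 = 0.
Proof.
by move=> /positive_functional_scalar[g _ e]; rewrite -!e raddf0.
Qed.

Lemma posfun_sum f (I : Type) (s : seq I) (P : pred I) (F : I -> E) :
  positive_functional f ->
  f (\sum_(i <- s | P i) F i) = \sum_(i <- s | P i) f (F i).
Proof.
move=> /positive_functional_scalar[g _ e]; rewrite -!e raddf_sum.
by apply: eq_bigr => i _; exact: e.
Qed.

Lemma posfun_ge0 f x : positive_functional f -> 0 <= x -> 0 <= f x.
Proof. by case=> _ h _; exact: h. Qed.

Lemma posfun_le f x y : positive_functional f -> x <= y -> f x <= f y.
Proof.
by move=> pf xy; rewrite -subr_ge0 -posfunB// posfun_ge0// bl_subr_ge0.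
Qed.

Lemma posfun_bound f : positive_functional f ->
  exists2 M : R, 0 < M & forall x, `|f x| <= M * `|x|.
Proof.
case=> _ _ [M fM]; exists (`|M| + 1); first by rewrite ltr_wpDl.
move=> x; rewrite (le_trans (fM x))// ler_wpM2r// (le_trans (ler_norm _))//.
by rewrite lerDl.
Qed.

(** The lattice seminorm attached to a positive functional. *)
Lemma posfun_seminorm f : positive_functional f -> seminorm (f \o modulus (E := E)).
Proof.
move=> pf; split=> [x y|t x] /=; last by rewrite modulusZ posfunZ.
by rewrite -posfunD// posfun_le// modulusD.
Qed.

Lemma posfun_cvg f (z : nat -> E) (l : E) : positive_functional f ->
  z @ \oo --> l -> f \o z @ \oo --> f l.
Proof.
move=> /positive_functional_scalar[g gc e] zl.
rewrite (_ : f \o z = g \o z); last by apply/funext => n /=; rewrite e.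
by rewrite -e; apply: continuous_cvg => //; exact: gc.
Qed.

Lemma posfun_weakly_null f (y : nat -> E) : positive_functional f ->
  weakly_null y -> f \o y @ \oo --> (0 : R).
Proof.
move=> /positive_functional_scalar[g gc e] wy.
by rewrite (_ : f \o y = g \o y); [exact: wy|apply/funext => n /=; rewrite e].
Qed.

(** The Hahn-Banach theorem for the sublinear functional |x^+|. *)
Lemma norming_positive_functional z : 0 <= z -> exists f,
  [/\ positive_functional f, forall x, `|f x| <= `|x| & f z = `|z|].
Proof.
move=> z0.
have sp : sublinear (fun x : E => `|pospart x|).
  split=> [x y|t x t0]; last by rewrite pospartZ// normrZ ger0_norm.
  rewrite (le_trans _ (ler_normD _ _))// bl_norm_le_pos ?pospart_ge0//.
  exact: pospartD.
have [f [fp fz]] := hahn_banach z sp.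
have fn x : `|f x| <= `|x|.
  rewrite ler_norml lerNl -raddfN -{1}(normrN x).
  by rewrite !(le_trans (fp _)) ?norm_pospart.
exists f; split=> //; last by rewrite fz pospart_id.
split.
- by move=> a x y; rewrite linearP.
- by move=> x x0; rewrite -oppr_le0 -raddfN (le_trans (fp _))// pospart_le0 ?normr0//
  bl_oppr_le0.
- by exists 1 => x; rewrite mul1r.
Qed.

End PositiveFunctionals.

(** * Functionals controlling the norm on an order interval *)

Section ControllingFunctional.
Context (R : realType) (E : banachLatticeType R).
Implicit Types (f : E -> R) (x y z u : E).

(** Otherwise there are z_n in [0, u] of norm at least e, with norming positive
    functionals g_n, such that g_i (z_n) is tiny for i < n.  Then the decreasing
    sequence W_n = sup_(k >= n) z_k satisfies g_n (W_n - W_(n+1)) >= 3e/4, so it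
    is not Cauchy. *)
Lemma controlling_functional_eps u (e : R) : order_continuous E -> 0 <= u ->
  0 < e -> exists2 f, positive_functional f & exists2 d : R, 0 < d &
    forall z, 0 <= z -> z <= u -> f z < d -> `|z| < e.
Proof.
move=> hE u0 e0; apply: contrapT => H.
have {}H f (d : R) : positive_functional f -> 0 < d ->
    exists z, [/\ 0 <= z, z <= u, f z < d & e <= `|z|].
  move=> pf d0; apply: contrapT => H'; apply: H; exists f => //;
    exists d => // z z0 zu fz.
  by rewrite ltNge; apply/negP => ez; apply: H'; exists z.
have /choice[g gP] : forall z, exists g, 0 <= z ->
    [/\ positive_functional g, forall x, `|g x| <= `|x| & g z = `|z|].
  move=> z; have [z0|/negP z0] := boolP (0 <= z); last by exists (fun=> 0).
  by have [g gP] := norming_positive_functional z0; exists g.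
pose F (s : seq E) x := \sum_(w <- s) g w x.
have posF s : (forall w, w \in s -> 0 <= w) -> positive_functional (F s).
  move=> s0; split.
  - move=> a x y; rewrite /F mulr_sumr -big_split/= big_seq [RHS]big_seq.
    by apply: eq_bigr => w /s0/gP[pg _ _]; rewrite posfunD// posfunZ.
  - move=> x x0; rewrite /F big_seq; apply: sumr_ge0 => w /s0/gP[pg _ _].
    exact: posfun_ge0.
  - exists (size s)%:R => x; rewrite /F big_seq (le_trans (ler_norm_sum _ _ _))//.
    apply: (@le_trans _ _ (\sum_(w <- s) `|x|)).
      by rewrite [leRHS]big_seq; apply: ler_sum => w /s0/gP[_ + _]; exact.
    by rewrite big_const_seq count_predT iter_addr_0 mulr_natl.
pose r k := e / 8 * 2^-1 ^+ k.
have r0 k : 0 < r k by rewrite mulr_gt0 ?divr_gt0 ?exprn_gt0 ?invr_gt0.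
have /choice[pick pickP] : forall s : seq E, exists z, (forall w, w \in s -> 0 <= w) ->
    [/\ 0 <= z, z <= u, F s z < r (size s) & e <= `|z|].
  move=> s; have [s0|] := pselect (forall w, w \in s -> 0 <= w); last by exists 0.
  by have [z zP] := H _ _ (posF s s0) (r0 (size s)); exists z.
pose L := fix L k := if k is k'.+1 then rcons (L k') (pick (L k')) else [::].
pose z k := pick (L k).
have LE k : L k = mkseq z k by elim: k => //= k ih; rewrite mkseqS -ih.
have L0 k : forall w, w \in L k -> 0 <= w.
  elim: k => //= k ih w; rewrite mem_rcons inE => /predU1P[->|]; last exact: ih.
  by have [] := pickP _ ih.
have z0 k : 0 <= z k by have [] := pickP _ (L0 k).
have zu k : z k <= u by have [] := pickP _ (L0 k).
have ez k : e <= `|z k| by have [] := pickP _ (L0 k).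
have gz i k : (i < k)%N -> g (z i) (z k) <= r k.
  move=> ik; have [_ _ + _] := pickP _ (L0 k).
  have -> : size (L k) = k by rewrite LE size_mkseq.
  move=> /ltW; apply: le_trans.
  have iL : z i \in L k by rewrite LE; apply: map_f; rewrite mem_iota.
  rewrite /F (big_rem _ iL)/= lerDl big_seq;
    apply: sumr_ge0 => w /mem_rem/L0/gP[pg _ _].
  exact: posfun_ge0 pg (z0 k).
have [W [zW WS WV]] := tail_suprema hE z0 zu.
have W0 n : 0 <= W n by exact: le_trans (z0 n) (zW n).
have gW n : g (z n) (W n.+1) <= e / 4.
  have [pg _ _] := gP _ (z0 n).
  have [V VW Vb] := WV n.+1.
  apply: (ler_cvg_to (posfun_cvg pg VW) (@cvg_cst _ (e / 4) _ \oo _)).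
  apply: nearW => N /=.
  apply: (@le_trans _ _ (\sum_(k < N) g (z n) (z (n.+1 + k)%N))).
    by rewrite -posfun_sum//; apply: posfun_le => //; case: (Vb N).
  apply: (@le_trans _ _ (\sum_(k < N) e / 8 * 2^-1 ^+ k)).
    apply: ler_sum => k _; apply: le_trans (gz _ _ _) _;
      first by rewrite addSn ltnS leq_addr.
    rewrite ler_pM2l ?divr_gt0// ler_wiXn2l ?invr_ge0 ?invf_le1 ?ler1n//.
    exact: leq_addl.
  rewrite -mulr_sumr (le_trans (ler_wpM2l _ (sum_half_le R N))) ?divr_ge0 ?(ltW e0)//.
  by lra.
have Wn n : e / 2 <= `|W n - W n.+1|.
  have [pg gn gzz] := gP _ (z0 n).
  rewrite (le_trans _ (gn _))// (le_trans _ (ler_norm _))// posfunB//.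
  have := gW n; have := posfun_le pg (zW n); have := ez n; rewrite gzz; lra.
have Wc : cvgn (fun n => - W n).
  by apply: (order_continuous_cvgn (u := 0) hE) => n; rewrite ?bl_lerN2 ?bl_oppr_le0.
have Wc' := Wc; rewrite -cvg_shiftS in Wc'.
have : (fun n => - W n - - W n.+1) @ \oo --> limn (fun n => - W n) - limn (fun n =>
  - W n).
  exact: cvgB.
rewrite subrr => /cvgr0Pnorm_lt/(_ _ (divr_gt0 e0 (ltr0n R 2)))[N _ /(_ N (leqnn _))].
by rewrite /= distrC opprK addrC ltNge Wn.
Qed.

(** A weighted sum of the functionals obtained for e = 1 / (k + 1). *)
Lemma controlling_functional u : order_continuous E -> 0 <= u ->
  exists2 f, positive_functional f & forall e : R, 0 < e ->
    exists2 d : R, 0 < d & forall z, 0 <= z -> z <= u -> f z < d -> `|z| < e.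
Proof.
move=> hE u0.
have /choice[f fP] : forall k : nat, exists f, positive_functional f /\
    exists2 d : R, 0 < d & forall z, 0 <= z -> z <= u -> f z < d -> `|z| < k.+1%:R^-1.
  move=> k; have k0 : 0 < k.+1%:R^-1 :> R by rewrite invr_gt0.
  by have [f pf h] := controlling_functional_eps hE u0 k0; exists f.
have pf k : positive_functional (f k) by exact: (fP k).1.
have /choice[M MP] : forall k, exists M : R, 0 < M /\ forall x, `|f k x| <= M * `|x|.
  by move=> k; have [M M0 h] := posfun_bound (pf k); exists M.
pose a k := 2^-1 ^+ k / M k.
have a0 k : 0 < a k by rewrite divr_gt0 ?exprn_gt0 ?invr_gt0//; exact: (MP k).1.
pose h x k := a k * f k x.
have hb x k : `|h x k| <= geometric `|x| 2^-1 k.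
  rewrite /h normrM gtr0_norm// (le_trans (ler_wpM2l _ ((MP k).2 x))) ?(ltW (a0 k))//.
  by rewrite /a mulrA mulfVK ?gt_eqF ?(MP k).1//= mulrC.
have half1 : `|2^-1 : R| < 1 by rewrite ger0_norm ?invr_ge0// invf_lt1 ?ltr1n.
have hc x : cvgn (series (h x)).
  apply: normed_cvg; apply: series_le_cvg (hb x) _ => [k|k|].
  - exact: normr_ge0.
  - exact: le_trans (normr_ge0 _) (hb x k).
  - exact: is_cvg_geometric_series.
pose g x := limn (series (h x)).
have gle x k : 0 <= x -> h x k <= g x.
  move=> x0; have h0 i : 0 <= h x i by rewrite mulr_ge0 ?(ltW (a0 i))// posfun_ge0.
  rewrite (le_trans _ (nondecreasing_cvgn_le _ (hc x) k.+1))//.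
    by rewrite /series/= big_nat_recr//= lerDr sumr_ge0.
  by apply/nondecreasing_seqP => n; rewrite /series/= big_nat_recr//= lerDl.
exists g; last first.
  move=> e e0.
  have [k hk] : exists k : nat, k.+1%:R^-1 <= e.
    exists (Num.truncn e^-1); rewrite invf_ple ?posrE//.
    by rewrite ltW// truncnS_gt// invr_ge0 ltW.
  have [d d0 dP] := (fP k).2; exists (a k * d); first by rewrite mulr_gt0.
  move=> z z0 zu gz; apply: lt_le_trans hk; apply: dP => //.
  by rewrite -(ltr_pM2l (a0 k)) (le_lt_trans _ gz)// gle.
split.
- move=> b x y; apply: cvg_lim => //.
  rewrite (_ : series (h (b *: x + y)) = fun n => b * series (h x) n + series (h y) n).
    by apply: cvgD; [apply: cvgMr; exact: hc|exact: hc].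
  apply/funext => n; rewrite /series/= mulr_sumr -big_split/=.
  by apply: eq_bigr => k _; rewrite /h posfunD// posfunZ// mulrDr mulrCA.
- move=> x x0; rewrite (le_trans _ (gle x 0%N x0))// mulr_ge0 ?(ltW (a0 0%N))//.
  exact: posfun_ge0.
- exists 2 => x.
  apply: (ler_cvg_to (cvg_norm (hc x)) (@cvg_cst _ (2 * `|x|) _ \oo _)).
  apply: nearW => n; rewrite /series/= (le_trans (ler_norm_sum _ _ _))//.
  apply: (@le_trans _ _ (\sum_(i < n) `|x| * 2^-1 ^+ i)).
    by rewrite big_mkord; apply: ler_sum => i _; exact: hb.
  by rewrite -mulr_sumr mulrC ler_wpM2r// sum_half_le.
Qed.

End ControllingFunctional.

(** * Almost disjoint sequences *)

Section AlmostDisjoint.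
Context (R : realType) (E : banachLatticeType R).
Implicit Types (z : nat -> E).

Lemma meet_sum_le (I : Type) (s : seq I) (F : I -> E) (x : E) (c : R) :
  1 <= c -> 0 <= x -> (forall i, 0 <= F i) ->
  Order.meet x (c *: \sum_(i <- s) F i) <= c *: \sum_(i <- s) Order.meet x (F i).
Proof.
move=> c1 x0 F0.
have h : Order.meet x (\sum_(i <- s) F i) <= \sum_(i <- s) Order.meet x (F i).
  elim: s => [|i s ih]; first by rewrite !big_nil leIr.
  rewrite !big_cons meetC (le_trans (meet_addl _ _ _))// ?bl_sumr_ge0//.
  by rewrite ![Order.meet _ x]meetC bl_lerD2l.
rewrite meetC (le_trans (meet_scale_le _ _ _))// ?bl_sumr_ge0//.
by rewrite meetC bl_ler_wpZ2l// (le_trans ler01).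
Qed.

(** The extraction of Kadec and Pelczynski.  Along a subsequence for which
    z_k /\ 4^k (z_0 + ... + z_(k-1)) is small, and with W dominating all the
    2^-k z_k, the elements (z_k - 4^k (z_0 + ... + z_(k-1)) - 2^-k W)^+ are
    pairwise disjoint. *)
Lemma almost_disjoint_subseq z (M : R) : (forall n, 0 <= z n) ->
  (forall n, `|z n| <= M) ->
  (forall i, (fun n => `|Order.meet (z n) (z i)|) @ \oo --> (0 : R)) ->
  exists2 phi, increasing_seq phi & exists d : nat -> E,
    [/\ forall k, 0 <= d k, forall k, d k <= z (phi k),
        forall i j, i != j -> Order.meet (d i) (d j) = 0 &
        (fun k => `|z (phi k) - d k|) @ \oo --> (0 : R)].
Proof.
move=> z0 zM zz.
have [|phi hphi Pphi] := @fast_subseq (fun s n =>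
    `|Order.meet (z n) (4 ^+ size s *: \sum_(i <- s) z i)| <= 2^-1 ^+ size s).
  move=> s; pose S n : R := 4 ^+ size s * \sum_(i <- s) `|Order.meet (z n) (z i)|.
  have Sc : S @ \oo --> 4 ^+ size s * \sum_(i <- s) (0 : R).
    apply: cvgMr; elim: s {S} => [|i s ih].
      by rewrite (_ : (fun _ => _) = fun=> 0) ?big_nil;
        [exact: cvg_cst|apply/funext => n; rewrite big_nil].
    rewrite (_ : (fun _ => _) = fun n =>
      `|Order.meet (z n) (z i)| + \sum_(i <- s) `|Order.meet (z n) (z i)|); last first.
      by apply/funext => n; rewrite big_cons.
    by rewrite big_cons; apply: cvgD; [exact: zz|exact: ih].
  rewrite big1// mulr0 in Sc; move/cvgr0Pnorm_le : Sc.
  have h0 : 0 < 2^-1 ^+ size s :> R by rewrite exprn_gt0// invr_gt0.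
  move=> /(_ _ h0); apply: filterS => n /(le_trans (ler_norm _)); apply: le_trans.
  apply: (@le_trans _ _ `|4 ^+ size s *: \sum_(i <- s) Order.meet (z n) (z i)|).
    rewrite bl_norm_le_pos ?meet_ge0 ?bl_scaler_ge0 ?exprn_ge0 ?bl_sumr_ge0//.
    by rewrite meet_sum_le// exprn_ege1// ler1n.
  rewrite normrZ ger0_norm ?exprn_ge0// ler_wpM2l ?exprn_ge0//.
  exact: ler_norm_sum.
have [W W0 zW] := weighted_dominant (fun n => z0 (phi n)) (fun n => zM (phi n)).
pose S k := 4 ^+ k *: \sum_(i < k) z (phi i).
have S0 k : 0 <= S k by rewrite bl_scaler_ge0 ?exprn_ge0 ?bl_sumr_ge0.
have h0 k : 0 <= 2^-1 ^+ k :> R by rewrite exprn_ge0// invr_ge0.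
pose d k := pospart (z (phi k) - (S k + 2^-1 ^+ k *: W)).
have d0 k : 0 <= d k by exact: pospart_ge0.
have SW0 k : 0 <= S k + 2^-1 ^+ k *: W by rewrite bl_addr_ge0// bl_scaler_ge0.
have disj i j : (i < j)%N -> Order.meet (d i) (d j) = 0.
  move=> ij.
  apply: (@meet0_le _ _ (4^-1 ^+ j *: pospart (4 ^+ j *: z (phi i) - z (phi j)))
     (pospart (z (phi j) - 4 ^+ j *: z (phi i)))) => //.
  - rewrite -pospartZ ?exprn_ge0 ?invr_ge0// le_pospart//.
    rewrite scalerBr scalerA -exprMn mulVf ?pnatr_eq0// expr1n scale1r bl_lerD2l
      bl_lerN2.
    apply: (@le_trans _ _ (2^-1 ^+ i *: W)); last by rewrite addrC bl_lerDl.
    apply: (@le_trans _ _ (4^-1 ^+ j *: (2 ^+ j *: W))).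
      by rewrite bl_ler_wpZ2l ?exprn_ge0 ?invr_ge0.
    rewrite scalerA -exprMn bl_ler_wZ2r// (_ : 4^-1 * 2 = 2^-1); last by field.
    by rewrite ler_wiXn2l ?invr_ge0 ?invf_le1 ?ler1n// ltnW.
  - rewrite le_pospart// bl_lerD2l bl_lerN2.
    apply: (@le_trans _ _ (S j)); last by rewrite bl_lerDl// bl_scaler_ge0.
    rewrite bl_ler_wpZ2l ?exprn_ge0// (bigD1 (Ordinal ij))//= bl_lerDl//.
    exact: bl_sumr_ge0.
  - rewrite meet0Z ?pospart_ge0 ?exprn_ge0 ?invr_ge0//.
    exact: pospartB_meet0.
exists phi => //; exists d; split=> //.
- by move=> k; rewrite pospart_le// bl_lerBlDr bl_lerDl.
- by move=> i j; rewrite neq_ltn => /orP[/disj//|/disj]; rewrite meetC.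
have bound k : `|z (phi k) - d k| <= (1 + `|W|) * 2^-1 ^+ k.
  rewrite bl_subr_pospart.
  apply: (@le_trans _ _ (`|Order.meet (z (phi k)) (S k) + 2^-1 ^+ k *: W|)).
    rewrite bl_norm_le_pos ?meet_ge0//.
    rewrite meetC (le_trans (meet_addl (S0 k) (bl_scaler_ge0 (h0 k) W0) (z0 _)))//.
    by rewrite [Order.meet (S k) _]meetC bl_lerD2l leIl.
  rewrite (le_trans (ler_normD _ _))// normrZ ger0_norm// mulrDl mul1r [`|W| *
    _]mulrC lerD2r.
  have e : \sum_(i <- mkseq phi k) z i = \sum_(i < k) z (phi i).
    by rewrite big_map -{1}[k]subn0 big_mkord.
  by have := Pphi k; rewrite size_mkseq e.
have half1 : `|2^-1 : R| < 1 by rewrite ger0_norm ?invr_ge0// invf_lt1 ?ltr1n.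
apply: (@squeeze_cvgr _ _ _ _ (fun=> 0) (geometric (1 + `|W|) 2^-1)).
- by apply: nearW => k; rewrite normr_ge0 bound.
- exact: cvg_cst.
- exact: cvg_geometric.
Qed.

End AlmostDisjoint.

(** * Uniform integrability of weakly null sequences *)

Section UniformIntegrability.
Context (R : realType) (E : banachLatticeType R).
Implicit Types (f : E -> R) (x d u w : E) (y : nat -> E).

(** The part of the seminorm [f \o modulus] carried by the band generated by d. *)
Definition band_seminorm f d x : R :=
  sup (range (fun n : nat => f (Order.meet (modulus x) (n%:R *: d)))).

Section BandSeminorm.
Variables (f : E -> R) (d : E).
Hypotheses (pf : positive_functional f) (d0 : 0 <= d).

Let nd0 (n : nat) : 0 <= n%:R *: d. Proof. by rewrite bl_scaler_ge0 ?ler0n. Qed.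

Lemma band_seminorm_cvg x :
  (fun n : nat => f (Order.meet (modulus x) (n%:R *: d))) @ \oo --> band_seminorm f d x.
Proof.
apply: nondecreasing_cvgn; last first.
  by exists (f (modulus x)) => _ [n _ <-]; rewrite posfun_le// leIl.
move=> m n mn; rewrite posfun_le// leI2// bl_ler_wZ2r//.
by rewrite ler_nat.
Qed.

Lemma band_seminorm_ub x (n : nat) :
  f (Order.meet (modulus x) (n%:R *: d)) <= band_seminorm f d x.
Proof.
apply: ub_le_sup; last by exists n.
by exists (f (modulus x)) => _ [m _ <-]; rewrite posfun_le// leIl.
Qed.

Lemma band_seminorm_lub x (b : R) :
  (forall n : nat, f (Order.meet (modulus x) (n%:R *: d)) <= b) ->
  band_seminorm f d x <= b.
Proof.
move=> h; apply: ge_sup; last by move=> _ [n _ <-].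
by exists (f (Order.meet (modulus x) (0%:R *: d))), 0%N.
Qed.

Lemma band_seminormP : seminorm (band_seminorm f d).
Proof.
have le (t : R) x : t != 0 -> band_seminorm f d (t *: x) <= `|t| * band_seminorm f d x.
  move=> t0; have nt : 0 < `|t| by rewrite normr_gt0.
  apply: band_seminorm_lub => n.
  pose m := (Num.truncn (n%:R / `|t|)).+1.
  apply: (@le_trans _ _ (`|t| * f (Order.meet (modulus x) (m%:R *: d)))).
    rewrite -posfunZ// posfun_le// bl_scaleI// -modulusZ leI2// scalerA bl_ler_wZ2r//.
    by rewrite mulrC -ler_pdivrMr// ltW// truncnS_gt// divr_ge0.
  by rewrite ler_wpM2l// band_seminorm_ub.
split=> [x y|t x].
  apply: band_seminorm_lub => n.
  apply: (@le_trans _ _ (f (Order.meet (modulus x) (n%:R *: d)) +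
                         f (Order.meet (modulus y) (n%:R *: d)))).
    rewrite -posfunD// posfun_le// (le_trans _ (meet_addl _ _ _)) ?modulus_ge0//.
    by rewrite leI2// modulusD.
  by rewrite lerD// band_seminorm_ub.
have [->|t0] := eqVneq t 0.
  rewrite scale0r normr0 mul0r; apply/le_anti/andP; split.
    apply: band_seminorm_lub => n.
    by rewrite modulus_id// meet_l// posfun0.
  rewrite (le_trans _ (band_seminorm_ub 0 0))// posfun_ge0// meet_ge0 ?modulus_ge0//.
apply/le_anti; rewrite le//=.
have := le t^-1 (t *: x); rewrite invr_eq0 scalerA mulVf// scale1r => /(_ t0).
by rewrite normfV mulrC ler_pdivlMr ?normr_gt0// mulrC.
Qed.

End BandSeminorm.

(** A finite family of pairwise disjoint elements below w has its sum below w. *)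
Lemma sum_disjoint_le (a : nat -> E) w N : (forall i, 0 <= a i) ->
  (forall i, a i <= w) -> (forall i j, i != j -> Order.meet (a i) (a j) = 0) ->
  0 <= w -> \sum_(i < N) a i <= w.
Proof.
move=> a0 aw disj w0; elim: N => [|N ih]; first by rewrite big_ord0.
rewrite big_ord_recr/= -meet0_join; first by rewrite leUx ih aw.
apply: (meet0_sum (a0 N) _).2 => i _ _; split; first exact: a0.
by apply: disj; rewrite ltn_eqF.
Qed.

Lemma sum_band_seminorm_le f (d : nat -> E) N x : positive_functional f ->
  (forall k, 0 <= d k) -> (forall i j, i != j -> Order.meet (d i) (d j) = 0) ->
  \sum_(k < N) band_seminorm f (d k) x <= f (modulus x).
Proof.
move=> pf d0 disj.
have c : (fun n : nat => \sum_(k < N) f (Order.meet (modulus x) (n%:R *: d k))) @ \oo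
  -->
    \sum_(k < N) band_seminorm f (d k) x.
  elim: N => [|N ih].
    rewrite big_ord0 (_ : (fun _ => _) = fun=> 0); first exact: cvg_cst.
    by apply/funext => n; rewrite big_ord0.
  rewrite big_ord_recr/= (_ : (fun _ => _) = fun n : nat =>
     \sum_(k < N) f (Order.meet (modulus x) (n%:R *: d k)) +
     f (Order.meet (modulus x) (n%:R *: d N))).
    by apply: cvgD => //; exact: band_seminorm_cvg.
  by apply/funext => n; rewrite big_ord_recr.
apply: (ler_cvg_to c (@cvg_cst _ (f (modulus x)) _ \oo _)).
apply: nearW => n; rewrite -posfun_sum// posfun_le//.
have nd0 k : 0 <= n%:R *: d k by rewrite bl_scaler_ge0 ?ler0n.
apply: (@sum_disjoint_le (fun k => Order.meet (modulus x) (n%:R *: d k))).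
- by move=> i; rewrite meet_ge0 ?modulus_ge0.
- by move=> i; exact: leIl.
- move=> i j ij; apply: (@meet0_le _ _ (n%:R *: d i) (n%:R *: d j)).
  + by rewrite meet_ge0 ?modulus_ge0.
  + by rewrite meet_ge0 ?modulus_ge0.
  + exact: leIr.
  + exact: leIr.
  + by rewrite meet0Z ?ler0n// meetC meet0Z ?ler0n// disj// eq_sym.
- exact: modulus_ge0.
Qed.

(** Chebyshev's inequality: (a - t u)^+ lives where u <= a / t. *)
Lemma meet_pospart_le (a u : E) (c t : R) : 0 <= a -> 0 <= u -> 0 < t -> 0 <= c ->
  Order.meet (pospart (a - t *: u)) (c *: u) <= (c / t) *: a.
Proof.
move=> a0 u0 t0 c0.
set A := pospart _; pose B := pospart (t *: u - a).
have A0 : 0 <= A by exact: pospart_ge0.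
have B0 : 0 <= B by exact: pospart_ge0.
have ct0 : 0 <= c / t by rewrite divr_ge0// ltW.
have tN0 : t != 0 by rewrite gt_eqF.
have h : c *: u <= (c / t) *: a + (c / t) *: B.
  rewrite -scalerDr (_ : c *: u = (c / t) *: (t *: u)); last by rewrite scalerA mulfVK.
  by rewrite bl_ler_wpZ2l// addrC -bl_lerBlDr; exact: pospart_ge.
apply: (@le_trans _ _ (Order.meet ((c / t) *: a + (c / t) *: B) A)).
  by rewrite meetC leI2.
rewrite (le_trans (meet_addl _ _ _)) ?bl_scaler_ge0//.
rewrite [X in _ + X <= _](_ : _ = 0) ?addr0 ?leIl//.
by rewrite meet0Z//; exact: pospartB_meet0.
Qed.

(** Uniform integrability of y, where f |.| plays the role of the L^1 norm and u
    that of the constant function 1. *)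
Definition uniformly_integrable f u y := forall e : R, 0 < e ->
  exists2 c : R, 0 <= c &
    forall n, f (pospart (modulus (y n) - c *: u)) <= e.

(** Weakly null sequences are uniformly integrable.  Otherwise the parts of
    y_n above n u contain almost disjoint pieces on which f is bounded below,
    which the gliding hump argument rules out. *)
Lemma weakly_null_uniformly_integrable f u y : positive_functional f ->
  weakly_null y -> 0 <= u -> (forall n, modulus (y n) <= 2 ^+ n *: u) ->
  uniformly_integrable f u y.
Proof.
move=> pf wy u0 yu e e0; apply: contrapT => H.
have [M yM] := weakly_null_bounded wy.
have [Mf Mf0 fM] := posfun_bound pf.
pose w (k n : nat) := pospart (modulus (y n) - k%:R *: u).
have [|phi hphi Pphi] := @frequent_subseq (fun k n => e < f (w k n)).
  move=> k N; apply: contrapT => h; apply: H.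
  exists (k%:R + 2 ^+ N); first by rewrite addr_ge0 ?exprn_ge0.
  move=> n; rewrite leNgt; apply/negP => lt.
  have [nN|Nn] := ltnP n N.
    move: lt; rewrite pospart_le0 ?posfun0 ?(lt_gtF e0)//.
    rewrite bl_lerBlDr add0r (le_trans (yu n))// bl_ler_wZ2r//.
    by rewrite ler_wpDl// ler_weXn2l ?ler1n// ltnW.
  apply: h; exists n => //; apply: lt_le_trans lt _; rewrite posfun_le// le_pospart//.
  by rewrite bl_lerD2l bl_lerN2 bl_ler_wZ2r// lerDl exprn_ge0.
pose z k := w k (phi k).
have z0 k : 0 <= z k by exact: pospart_ge0.
have zy k : z k <= modulus (y (phi k)).
  by rewrite pospart_le ?modulus_ge0// bl_lerBlDr bl_lerDl// bl_scaler_ge0.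
have zM k : `|z k| <= M.
  by rewrite (le_trans (bl_norm_le_pos (z0 k) (zy k)))// norm_modulus.
have M0 : 0 <= M by rewrite (le_trans _ (zM 0%N)).
have zz i : (fun n => `|Order.meet (z n) (z i)|) @ \oo --> (0 : R).
  apply/cvgr0Pnorm_le => r r0; near=> n.
  have n0 : 0 < n%:R :> R by rewrite ltr0n; near: n; exists 1%N.
  rewrite normr_id.
  apply: (@le_trans _ _ (2 ^+ phi i / n%:R * M)); last first.
    rewrite mulrAC ler_pdivrMr// mulrC -ler_pdivrMl// mulrC.
    by near: n; exact: nbhs_infty_ger.
  have c0 : 0 <= 2 ^+ phi i / n%:R :> R by rewrite divr_ge0 ?exprn_ge0// ltW.
  apply: (@le_trans _ _ `|(2 ^+ phi i / n%:R) *: modulus (y (phi n))|).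
    rewrite bl_norm_le_pos ?meet_ge0//.
    apply: (@le_trans _ _ (Order.meet (z n) (2 ^+ phi i *: u))).
      by rewrite leI2// (le_trans (zy i)).
    by rewrite meet_pospart_le ?modulus_ge0 ?exprn_ge0.
  by rewrite normrZ ger0_norm// ler_wpM2l// norm_modulus.
have [psi hpsi [d [d0 dz disj zd]]] := almost_disjoint_subseq z0 zM zz.
have [N _ fd] : \forall k \near \oo, e / 2 <= f (d k).
  have r0 : 0 < e / (2 * Mf) by rewrite divr_gt0// mulr_gt0.
  move/cvgr0Pnorm_le : zd => /(_ _ r0); apply: filterS => k.
  rewrite normr_id => zdk.
  have : `|f (z (psi k) - d k)| <= e / 2.
    rewrite (le_trans (fM _))// (le_trans (ler_wpM2l (ltW Mf0) zdk))//.
    by rewrite le_eqVlt; apply/orP; left; apply/eqP; field; rewrite gt_eqF.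
  move=> /(le_trans (ler_norm _)); rewrite posfunB//.
  have := Pphi (psi k); rewrite -/(z _); lra.
pose dN k := d (N + k)%N.
apply: (@gliding_hump _ _ (y \o (phi \o psi \o addn N))
    (fun k => band_seminorm f (dN k)) Mf (e / 2)).
- apply: weakly_null_subseq => //; apply: increasing_seq_comp;
  last exact: increasing_seq_addn.
  exact: increasing_seq_comp.
- by move=> k; apply: band_seminormP => //; exact: d0.
- move=> K v; apply: (@le_trans _ _ (f (modulus v))).
    apply: sum_band_seminorm_le => // [k|i j ij]; first exact: d0.
    by apply: disj; rewrite eqn_add2l.
  by rewrite (le_trans (ler_norm _))// (le_trans (fM _))// norm_modulus.
- by rewrite divr_gt0.
- move=> k; rewrite (le_trans (fd (N + k)%N (leq_addr _ _)))//.
  rewrite (le_trans _ (band_seminorm_ub _ pf _ 1))// scale1r meet_r//.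
  exact: le_trans (dz _) (zy _).
Unshelve. all: by end_near. Qed.

End UniformIntegrability.

(** * Small averages *)

Section SmallAverages.
Context (R : realType) (E : banachLatticeType R).
Implicit Types (f : E -> R) (x u v : E) (y : nat -> E).

Let sum_centered (J : nat) :
  \sum_(j < (2 * J).+1) (J%:R - j%:R) = 0 :> R.
Proof.
have h n : \sum_(j < n) (J%:R - j%:R) = n%:R * J%:R - n%:R * (n%:R - 1) / 2 :> R.
  elim: n => [|n ih]; first by rewrite big_ord0; field.
  by rewrite big_ord_recr/= ih -natr1; field.
by rewrite h -natr1 natrM; field.
Qed.

(** A weakly null sequence y that is uniformly integrable contains, arbitrarily
    far, finite sets with small average for [f \o modulus].  Put v = c u and
      G s = sum_(-J <= j <= J) f |s + j v|.
    The lattice identity |a + b| + |a - b| = 2 (|a| \/ |b|) bounds the second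
    difference of G in a direction b with |b| <= v by 2 f v, since the sum
    telescopes for b = v.  As G (s - y_k) is not much smaller than G s for k
    large, adding such a term y_k increases G by at most about 2 f v.  Finally
    G s >= (2J + 1) f |s|. *)
Lemma uniformly_integrable_small_average f u y (eps : R) :
  positive_functional f -> weakly_null y -> 0 <= u ->
  uniformly_integrable f u y -> 0 < eps ->
  exists m s, [/\ (0 < m)%N, sorted ltn s, size s = m, all (ltn m) s &
    f (modulus (\sum_(i <- s) y i)) < eps * m%:R].
Proof.
move=> pf wy u0 ui eps0; pose e := eps / 8; have e0 : 0 < e by rewrite divr_gt0.
have [c c0 hc] := ui e e0; pose v := c *: u; rewrite -/v in hc.
have v0 : 0 <= v by rewrite bl_scaler_ge0.
pose p x := f (modulus x); have sp : seminorm p by exact: posfun_seminorm.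
pose D := f v; have D0 : 0 <= D by exact: posfun_ge0.
have pv : p v = D by rewrite /p modulus_id.
pose J := (Num.truncn (D / e)).+1; pose n := (2 * J).+1.
have Dn : 2 * D <= e * n%:R.
  have : D / e < J%:R by exact: truncnS_gt.
  have -> : n%:R = 2 * J%:R + 1 :> R by rewrite -natrM natr1.
  by rewrite ltr_pdivrMr//; have := ler0n R J; nra.
pose m := (Num.truncn (J%:R * D / e)).+1.
have Jm : J%:R * D <= e * m%:R.
  by rewrite mulrC -[e * _]mulrC -ler_pdivrMr// [D * _]mulrC ltW// truncnS_gt//
    divr_ge0 ?mulr_ge0// ltW.
pose a (j : nat) s := s + (J%:R - j%:R) *: v.
pose G s := \sum_(j < n) p (a j s).
have pair x b : p (x + b) + p (x - b) <=
    p (x + v) + p (x - v) + 2 * f (pospart (modulus b - v)).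
  rewrite /p -(posfunZ 2 _ pf) -!(posfunD _ _ pf) posfun_le// !modulusDB -scalerDr.
  rewrite bl_ler_wpZ2l ?ler0n// leUx (modulus_id v0); apply/andP; split.
    by rewrite (le_trans (leUl _ v))// bl_lerDl// pospart_ge0.
  apply: (@le_trans _ _ (v + pospart (modulus b - v))); last by rewrite bl_lerD2r leUr.
  by rewrite addrC -bl_lerBlDr pospart_ge.
have shift s : \sum_(j < n) (p (a j s + v) + p (a j s - v)) <= 2 * G s + 2 * D.
  pose b (j : nat) := s + (J%:R + 1 - j%:R) *: v.
  have aS j : a j s - v = a j.+1 s.
    by rewrite /a -addrA -[X in _ - X]scale1r -scalerBl -natr1 opprD addrA.
  have ab j : a j s + v = b j.
    by rewrite /a /b [J%:R + 1 - _]addrAC [in RHS]scalerDl scale1r addrA.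
  have bS j : b j.+1 = a j s.
    by rewrite /a /b -natr1; congr (_ + _ *: _); ring.
  under eq_bigr do rewrite ab aS.
  rewrite big_split/=.
  have e1 : \sum_(j < n) p (a j.+1 s) = G s + p (a n s) - p (a 0%N s).
    have -> : G s + p (a n s) = \sum_(j < n.+1) p (a j s) by rewrite big_ord_recr.
    by rewrite [in RHS]big_ord_recl/= [in RHS]addrAC subrr add0r.
  have e2 : \sum_(j < n) p (b j) = p (b 0%N) + G s - p (b n).
    have : \sum_(j < n.+1) p (b j) = p (b 0%N) + G s.
      rewrite big_ord_recl/=; congr (_ + _); apply: eq_bigr => j _.
      by rewrite /bump/= add1n bS.
    by rewrite big_ord_recr/= => <-; rewrite addrK.
  have h1 : p (a n s) <= p (b n) + D.
    have -> : a n s = b n - v by rewrite -ab addrK.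
    by rewrite (le_trans (sp.1 _ _))// seminormN// pv.
  have h2 : p (b 0%N) <= p (a 0%N s) + D.
    by rewrite -ab (le_trans (sp.1 _ _))// pv.
  by rewrite e1 e2; lra.
have lsc x : \forall k \near \oo, p x - e <= p (x - y k).
  have [g [gp gx]] := hahn_banach x (seminorm_sublinear sp).
  have [Mf Mf0 fM] := posfun_bound pf.
  have gc : continuous g.
    apply: (seminorm_dominated_continuous sp gp (C := Mf)) => w.
    by rewrite (le_trans (ler_norm _))// (le_trans (fM _))// norm_modulus.
  have := weakly_null_near wy gc e0; apply: filterS => k gk.
  rewrite (le_trans _ (gp _))// raddfB/= gx lerD2l lerN2.
  exact: le_trans (ler_norm _) gk.
pose K := 2 * D + n%:R * (3 * e).
have step s : \forall k \near \oo, G (s + y k) <= G s + K.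
  have : \forall k \near \oo, forall j : 'I_n, p (a j s) - e <= p (a j s - y k).
    by apply: filter_forall => j; exact: lsc.
  apply: filterS => k hk.
  apply: (@le_trans _ _ (\sum_(j < n) ((p (a j s + v) + p (a j s - v)) +
      (3 * e - p (a j s))))).
    apply: ler_sum => j _.
    have -> : a j (s + y k) = a j s + y k by rewrite /a addrAC.
    by have := pair (a j s) (y k); have := hk j; have := hc k; lra.
  rewrite big_split/= sumrB sumr_const card_ord -mulr_natl -/(G s).
  by have := shift s; rewrite /K; lra.
(* The indices are chosen one by one, each increasing G by at most K. *)
have [|phi hphi Pphi] := @fast_subseq (fun s k => (m < k)%N /\
    G (\sum_(i <- s) y i + y k) <= G (\sum_(i <- s) y i) + K).
  move=> s; near=> k; split; near: k; last exact: step.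
  by exists m.+1.
have Gk k : G (\sum_(i <- mkseq phi k) y i) <= G 0 + k%:R * K.
  elim: k => [|k ih]; first by rewrite big_nil mul0r addr0.
  rewrite mkseqS big_rcons/= (le_trans (Pphi k).2)//.
  have -> : G 0 + k.+1%:R * K = G 0 + k%:R * K + K by rewrite -natr1; ring.
  exact: lerD ih (lexx K).
have Glow s : n%:R * p s <= G s.
  have -> : n%:R * p s = p (\sum_(j < n) a j s).
    rewrite /a big_split/= -scaler_suml sum_centered scale0r addr0.
    have -> : \sum_(i < n) s = n%:R *: s by rewrite sumr_const card_ord scaler_nat.
    by rewrite sp.2 ger0_norm.
  exact: seminorm_sum.
have G0 : G 0 <= n%:R * (J%:R * D).
  rewrite mulr_natl -[n in leRHS]card_ord -sumr_const; apply: ler_sum => j _.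
  rewrite /a add0r sp.2 pv ler_wpM2r//.
  have : (j%:R : R) <= 2 * J%:R by rewrite -natrM ler_nat -ltnS.
  by rewrite ler_norml; have := ler0n R j; lra.
exists m, (mkseq phi m); split=> //.
- by rewrite (increasing_seq_sorted _ hphi) iota_ltn_sorted.
- by rewrite size_mkseq.
- by apply/allP => _ /mapP[k _ ->]; exact: (Pphi k).1.
set S := \sum_(i <- _) _.
have n0 : 0 < n%:R :> R by rewrite ltr0n.
have m0 : 0 < m%:R :> R by rewrite ltr0n.
rewrite -(ltr_pM2l n0) (le_lt_trans (Glow S))// (le_lt_trans (Gk m))//.
apply: (@le_lt_trans _ _ (n%:R * (e * m%:R) + m%:R * (e * n%:R + n%:R * (3 * e)))).
  apply: lerD; first by rewrite (le_trans G0)// ler_wpM2l// ltW.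
  by rewrite ler_wpM2l ?(ltW m0)// /K lerD2r.
have em : 0 < e * (n%:R * m%:R) by apply: mulr_gt0 => //; exact: mulr_gt0.
have -> : eps = 8 * e by rewrite /e; field.
by lra.
Unshelve. all: by end_near. Qed.

End SmallAverages.

(** * Almost order bounded sequences *)

Section AlmostOrderBounded.
Context (R : realType) (F : banachLatticeType R).
Implicit Types (f : F -> R) (u v : F) (c : nat -> F).

(** If f controls the norm on [0, u], then on almost order bounded sequences
    in the ideal generated by u, convergence to 0 for [f \o modulus] implies
    convergence to 0 in norm. *)
Lemma almost_order_bounded_cvg0 f u c : order_continuous F ->
  positive_functional f -> 0 <= u ->
  (forall e : R, 0 < e -> exists2 d : R, 0 < d &
     forall z, 0 <= z -> z <= u -> f z < d -> `|z| < e) ->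
  (forall m, exists K : nat, modulus (c m) <= K%:R *: u) ->
  almost_order_bounded (range c) ->
  (fun m => f (modulus (c m))) @ \oo --> (0 : R) -> c @ \oo --> (0 : F).
Proof.
move=> hF pf u0 ctrl cu aob fc.
apply/cvgr0Pnorm_le => e e0; pose e3 := e / 3; have e30 : 0 < e3 by rewrite divr_gt0.
have [v v0 hv] := aob _ e30.
pose vk (k : nat) := Order.meet v (k%:R *: u).
have ku0 (k : nat) : 0 <= k%:R *: u by rewrite bl_scaler_ge0 ?ler0n.
have vS k : vk k <= vk k.+1.
  by rewrite leI2// bl_ler_wZ2r// ler_nat.
have vc : cvgn vk by apply: (order_continuous_cvgn hF vS (u := v)) => k; exact: leIl.
set v' := limn vk in vc.
have vv' := bl_cvg_ub vS vc.
have [k vk'] : exists k, `|v' - vk k| <= e3.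
  move/cvgrPdist_le : (vc : vk @ \oo --> v') => /(_ _ e30)[N _ h].
  by exists N; apply: h => /=.
have k10 : 0 < k.+1%:R :> R by rewrite ltr0n.
have [d d0 hd] := ctrl _ (divr_gt0 e30 k10).
move/cvgr0Pnorm_lt : fc => /(_ _ d0); apply: filterS => m.
rewrite ger0_norm ?posfun_ge0 ?modulus_ge0// => fcm.
set b := modulus (c m) in fcm *; have b0 : 0 <= b by exact: modulus_ge0.
have b1 : `|pospart (b - v)| <= e3.
  have [//|y /andP[vy yv] [w w1 cE]] := hv (c m).
  apply: (@le_trans _ _ `|e3 *: modulus w|); last first.
    rewrite normrZ norm_modulus ger0_norm ?(ltW e30)//.
    by rewrite ler_piMr// ltW.
  rewrite bl_norm_le_pos ?pospart_ge0// pospart_le//.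
    by rewrite bl_scaler_ge0 ?modulus_ge0// ltW.
  rewrite bl_lerBlDr /b -cE (le_trans (modulusD _ _))// modulusZ ger0_norm ?(ltW e30)//.
  rewrite addrC bl_lerD2l; apply/modulus_leP; split=> //.
  by rewrite bl_lerNl.
have b2 : Order.meet b v <= Order.meet b (k.+1%:R *: u) + (v' - vk k).
  have [K cK] := cu m.
  have bv' : Order.meet b v <= v'.
    apply: le_trans (vv' K); rewrite meetC leI2//.
  have vkv : 0 <= v' - vk k by rewrite bl_subr_ge0.
  have h : Order.meet b v <= Order.meet (vk k + (v' - vk k)) b.
    by rewrite addrC subrK lexI bv' leIl.
  rewrite (le_trans h)// (le_trans (meet_addl _ _ _))//.
    by rewrite meet_ge0.
  apply: bl_lerD; last exact: leIl.
  rewrite meetC leI2// (le_trans (leIr _ _))//.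
  by rewrite bl_ler_wZ2r// ler_nat.
have b3 : `|Order.meet b (k.+1%:R *: u)| <= e3.
  apply: (@le_trans _ _ `|k.+1%:R *: Order.meet b u|).
    rewrite bl_norm_le_pos ?meet_ge0// meetC (le_trans (meet_scale_le _ _ _)) ?ler1n//.
    by rewrite meetC.
  rewrite normrZ ger0_norm// mulrC -ler_pdivlMr// ltW// hd ?meet_ge0 ?leIr//.
  by rewrite (le_lt_trans _ fcm)// posfun_le// leIl.
rewrite -norm_modulus -/b.
have -> : b = Order.meet b v + pospart (b - v) by rewrite -bl_subr_pospart subrK.
rewrite (le_trans (ler_normD _ _))//.
have : `|Order.meet b v| <= e3 + e3.
  rewrite (le_trans (bl_norm_le_pos _ b2)) ?meet_ge0//.
  by rewrite (le_trans (ler_normD _ _))// lerD.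
by rewrite /e3 in b1 *; lra.
Qed.

End AlmostOrderBounded.

(** * Unbounded order convergence *)

Section UoNull.
Context (R : realType) (E : banachLatticeType R).
Implicit Types (x : nat -> E) (u w : E).

(** Order convergence implies norm convergence when the norm is order continuous. *)
Lemma uo_null_meet_cvg0 x w : order_continuous E -> uo_null x ->
  (forall n, 0 <= x n) -> 0 <= w ->
  (fun n => `|Order.meet (x n) w|) @ \oo --> (0 : R).
Proof.
move=> hE uo x0 w0; apply/cvgr0Pnorm_le => e e0.
have [I [r [y [dec h]]]] := uo w w0.
have [i0 hi0] := hE I r y dec e e0.
have [[_ rr _ _] _ _] := dec.
have [N hN] := h i0; exists N => // n /= Nn.
rewrite normr_id (le_trans _ (ltW (hi0 i0 (rr i0))))//.
apply: bl_norm_modulus_le; have := hN n Nn.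
by rewrite subr0 (modulus_id (x0 n)).
Qed.

(** A positive weakly null sequence x tends to 0 on the functional f controlling
    the norm of [0, u], where u dominates all the terms, so that x_n /\ u tends
    to 0 in norm.  Along a subsequence x_(n_k) with summable |x_(n_k) /\ u|,
    the positive lower bounds w of the suprema of x_(n_k) /\ v over k >= j are disjoint
    from u, hence from all the x_n, and therefore vanish. *)
Lemma weakly_null_uo_null_subseq x : order_continuous E ->
  (forall n, 0 <= x n) -> weakly_null x ->
  exists2 phi, increasing_seq phi & uo_null (x \o phi).
Proof.
move=> hE x0 wx.
have [M xM] := weakly_null_bounded wx.
have [u u0 xu] := weighted_dominant x0 xM.
have [f pf ctrl] := controlling_functional hE u0.
have fx := posfun_weakly_null pf wx.
have [|phi hphi Pphi] := @fast_subseq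
    (fun s n => `|Order.meet (x n) u| <= 2^-1 ^+ size s).
  move=> s; have s0 : 0 < 2^-1 ^+ size s :> R by rewrite exprn_gt0// invr_gt0.
  have [d d0 hd] := ctrl _ s0.
  move/cvgr0Pnorm_lt : fx => /(_ _ d0); apply: filterS => n /= fxn.
  rewrite ltW// hd ?meet_ge0 ?leIr//.
  rewrite (le_lt_trans _ fxn)// (le_trans _ (ler_norm _))// posfun_le//.
  exact: leIl.
exists phi => // v v0; pose z k := Order.meet (x (phi k)) v.
have z0 k : 0 <= z k by rewrite meet_ge0.
have zv k : z k <= v by exact: leIr.
have [W [zW WS WV]] := tail_suprema hE z0 zv.
have Wle m n : (m <= n)%N -> W n <= W m.
  move=> mn; rewrite -bl_lerN2.
  by apply: (@bl_nondecreasing _ _ (fun k => - W k)) => // k; rewrite bl_lerN2.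
exists nat, (fun i j => (i <= j)%N), W; split; last first.
  move=> i; exists i => n iN; rewrite subr0 /= modulus_id ?meet_ge0 ?modulus_ge0//.
  by rewrite modulus_id// (le_trans (zW n))// Wle.
split; last 1 first.
- split=> [_ [n _ <-]|t tW]; first exact: le_trans (z0 n) (zW n).
  rewrite (le_trans (pospart_ge t))//; set w := pospart t.
  have w0 : 0 <= w by exact: pospart_ge0.
  have wW n : w <= W n.
    by rewrite pospart_le ?(le_trans (z0 n))//; apply: tW; exists n.
  have wu : Order.meet w u = 0.
    apply/normr0_eq0/le_anti; rewrite normr_ge0 andbT.
    have bound n : `|Order.meet w u| <= 3 * 2^-1 ^+ n.
      have n0 : 0 < 2^-1 ^+ n :> R by rewrite exprn_gt0// invr_gt0.
      have [V VW Vb] := WV n.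
      move/cvgrPdist_le : (VW) => /(_ _ n0)[N _ /(_ N (leqnn N))] hV.
      have [V0 VWN VS] := Vb N.
      have WV0 : 0 <= W n - V N by rewrite bl_subr_ge0.
      have h : Order.meet w u <= (W n - V N) + \sum_(k < N) Order.meet (z (n + k)%N) u.
        apply: (@le_trans _ _ (Order.meet (W n - V N + V N) u)).
          by rewrite subrK leI2.
        rewrite (le_trans (meet_addl _ _ _))// bl_lerD ?leIl//.
        apply: (@le_trans _ _ (Order.meet (\sum_(k < N) z (n + k)%N) u)).
          by rewrite leI2.
        rewrite meetC -[\sum_(k < N) z _]scale1r.
        rewrite (le_trans (meet_sum_le _ _ _ _))// scale1r.
        by apply: bl_ler_sum => k _; rewrite meetC.
      rewrite (le_trans (bl_norm_le_pos _ h)) ?meet_ge0//.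
      rewrite (le_trans (ler_normD _ _))//.
      rewrite [leRHS](_ : _ = 2^-1 ^+ n + 2^-1 ^+ n * 2); last by ring.
      rewrite lerD// (le_trans (ler_norm_sum _ _ _))//.
      apply: (@le_trans _ _ (\sum_(k < N) 2^-1 ^+ n * 2^-1 ^+ k)); last first.
        by rewrite -mulr_sumr ler_wpM2l ?(ltW n0)// sum_half_le.
      apply: ler_sum => k _; rewrite -exprD.
      have := Pphi (n + k)%N; rewrite size_mkseq; apply: le_trans.
      by rewrite bl_norm_le_pos ?meet_ge0// leI2// leIl.
    have half1 : `|2^-1 : R| < 1 by rewrite ger0_norm ?invr_ge0// invf_lt1 ?ltr1n.
    apply: (ler_cvg_to (@cvg_cst _ _ _ \oo _) (@cvg_geometric _ 3 _ half1)).
    exact: nearW.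
  have zw k : Order.meet (z k) w = 0.
    apply: (@meet0_le _ _ (2 ^+ phi k *: u) w) => //.
      by rewrite (le_trans (leIl _ _)).
    by rewrite meet0Z ?exprn_ge0// meetC.
  have [V VW Vb] := WV 0%N.
  have h N : w <= W 0%N - V N.
    have [V0 VWN VS] := Vb N.
    have Vw : Order.meet (V N) w = 0.
      apply: (meet0_le V0 w0 VS (lexx w)).
      by apply: (meet0_sum w0 _).2 => k _ _; split; [exact: z0|exact: zw].
    apply: (@le_trans _ _ (Order.meet (W 0%N - V N + V N) w)).
      by rewrite subrK lexI wW lexx.
    rewrite (le_trans (meet_addl _ _ _)) ?bl_subr_ge0// Vw addr0; exact: leIl.
  rewrite -(subrr (W 0%N)).
  apply: (cvg_bl_le (@cvg_cst _ w _ \oo _) (cvgB (@cvg_cst _ (W 0%N) _ \oo _) VW)).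
  exact: nearW.
- split=> [|i|i j k|i j]; [exact: inhabits 0%N|exact: leqnn|exact: leq_trans|].
  by exists (maxn i j); rewrite leq_maxl leq_maxr.
- by move=> i j; exact: Wle.
Qed.

End UoNull.

(** * Cesàro means *)

Section Cesaro.
Context (R : realType) (F : banachLatticeType R).
Implicit Types (y z c : nat -> F).

Lemma cesaro_seqB y z : cesaro_seq (fun n => y n - z n) =
  (fun m => cesaro_seq y m - cesaro_seq z m).
Proof.
by apply/funext => m; rewrite /cesaro_seq /series/= sumrB scalerBr.
Qed.

Lemma cesaro_seq_cvg0 y : y @ \oo --> (0 : F) -> cesaro_seq y @ \oo --> (0 : F).
Proof.
move=> y0.
have ny0 : (fun n => `|y n|) @ \oo --> (0 : R) by rewrite -(normr0 F); exact: cvg_norm.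
apply/cvgr0Pnorm_le => e e0.
move/cvgr0Pnorm_le : (cesaro ny0) => /(_ e e0); apply: filterS => n.
apply: le_trans; rewrite /cesaro_seq /arithmetic_mean/= normrZ normrM ler_wpM2l//.
by rewrite /series/= (le_trans (ler_norm_sum _ _ _))// ler_norm.
Qed.

Lemma cvg_almost_order_bounded c : cvgn c -> almost_order_bounded (range c).
Proof.
move=> cc e e0; set l := limn c in cc.
move/cvgrPdist_le : (cc : c @ \oo --> l) => /(_ e e0)[N _ hN].
pose S := \sum_(i < N) modulus (c i).
have S0 : 0 <= S by rewrite bl_sumr_ge0// => i _; exact: modulus_ge0.
have u0 : 0 <= modulus l + S by rewrite bl_addr_ge0 ?modulus_ge0.
have in_itv (y : F) : modulus y <= modulus l + S ->
    - (modulus l + S) <= y <= modulus l + S.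
  by move/modulus_leP => [h1 h2]; rewrite h1 andbT bl_lerNl.
exists (modulus l + S) => // _ [n _ <-].
have [nN|Nn] := ltnP n N.
  exists (c n); last by exists 0; rewrite /= ?normr0// scaler0 addr0.
  apply: in_itv; rewrite (@le_trans _ _ S)//;
    last by rewrite addrC bl_lerDl ?modulus_ge0.
  rewrite /S (bigD1 (Ordinal nN))//= bl_lerDl// bl_sumr_ge0// => i _.
  exact: modulus_ge0.
exists l; first by apply: in_itv; rewrite bl_lerDl.
exists (e^-1 *: (c n - l)) => /=.
  by rewrite normrZ ger0_norm ?invr_ge0 ?(ltW e0)// ler_pdivrMl// mulr1 distrC;
    exact: hN.
by rewrite scalerA mulfV ?gt_eqF// scale1r addrC subrK.
Qed.

Lemma cesaro_seq_modulus_le u y m : (forall n, modulus (y n) <= 2 ^+ n *: u) ->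
  forall phi : nat -> nat, 0 <= u ->
  exists K : nat, modulus (cesaro_seq (y \o phi) m) <= K%:R *: u.
Proof.
move=> yu phi u0; exists (\sum_(k < m.+1) 2 ^ phi k)%N.
have h : modulus (series (y \o phi) m.+1) <= (\sum_(k < m.+1) 2 ^ phi k)%N%:R *: u.
  rewrite /series/= big_mkord (le_trans (modulus_sum _ _ _))//.
  rewrite natr_sum scaler_suml; apply: bl_ler_sum => k _.
  by rewrite natrX; exact: yu.
rewrite /cesaro_seq modulusZ ger0_norm ?invr_ge0//.
apply: le_trans h; rewrite -[leRHS]scale1r bl_ler_wZ2r ?modulus_ge0//.
by rewrite invf_le1 ?ler1n.
Qed.

(** If the Cesàro means of y tend to 0, so do its averages over the indices
    m + 1, ..., 2m. *)
Lemma cesaro_small_average y (eps : R) : cesaro_seq y @ \oo --> (0 : F) ->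
  0 < eps -> exists2 m, (0 < m)%N &
    `|\sum_(i <- iota m.+1 m) y i| < eps * m%:R.
Proof.
move=> cy eps0.
have e0 : 0 < eps / 6 by rewrite divr_gt0.
move/cvgr0Pnorm_le : cy => /(_ _ e0)[N _ hN].
pose m := N.+1; exists m => //.
have S n : \sum_(i <- iota 0 n.+1) y i = n.+1%:R *: cesaro_seq y n.
  by rewrite /cesaro_seq scalerA mulfV ?scale1r ?pnatr_eq0.
have -> : \sum_(i <- iota m.+1 m) y i =
    (m + m).+1%:R *: cesaro_seq y (m + m) - m.+1%:R *: cesaro_seq y m.
  by rewrite -!S -addSn iotaD big_cat/= addrAC subrr add0r.
have nz n (w : F) : `|n.+1%:R *: w| = n.+1%:R * `|w| by rewrite normrZ ger0_norm.
rewrite (le_lt_trans (ler_normB _ _))// !nz.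
have h1 : `|cesaro_seq y m| <= eps / 6 by apply: hN; rewrite /m /=.
have h2 : `|cesaro_seq y (m + m)| <= eps / 6 by apply: hN;
  rewrite /m /= addSn ltnW// ltnS leq_addr.
have m1 : 1 <= m%:R :> R by rewrite ler1n.
rewrite -[(m + m).+1%:R]natr1 -[m.+1%:R]natr1 natrD.
set a := `|_| in h2 *; set b := `|_| in h1 *.
apply: (@le_lt_trans _ _ ((m%:R + m%:R + 1) * (eps / 6) + (m%:R + 1) * (eps / 6))).
  by rewrite lerD// ler_wpM2l// ?addr_ge0// ler0n.
nra.
Qed.

End Cesaro.

(** * Images of positive weakly null sequences *)

Section MainImplications.
Context (R : realType) (E F : banachLatticeType R).
Variable T : {linear E -> F}.
Hypothesis hT : bounded_operator T.

Lemma bounded_operator_continuous : continuous T.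
Proof. exact: bounded_linear_continuous. Qed.

Lemma weakly_null_image x : weakly_null x -> weakly_null (T \o x).
Proof.
move=> wx f fc.
have lin : scalar (f \o T) by move=> a u v; rewrite /= linearP linearP.
pose g : {scalar E} := HB.pack (f \o T) (GRing.isLinear.Build R E R *%R (f \o T) lin).
apply: (wx g) => u; apply: continuous_comp; last exact: fc.
exact: bounded_operator_continuous.
Qed.

(** For positive weakly null x whose subsequences have subsequences with almost
    order bounded Cesàro means of the images, some subsequence of T x has all
    its subsequences Cesàro null in norm: the heredity is obtained first for
    the seminorm of a functional controlling the norm, then for the norm. *)
Lemma hereditary_cesaro_null_image x : order_continuous F -> weakly_null x ->
  (forall phi, increasing_seq phi -> has_aob_cesaro_subseq (T \o (x \o phi))) ->
  exists2 psi, increasing_seq psi & forall chi, increasing_seq chi ->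
    cesaro_seq (T \o x \o psi \o chi) @ \oo --> (0 : F).
Proof.
move=> hF wx haob; pose y := T \o x.
have wy : weakly_null y by exact: weakly_null_image.
have [M yM] := weakly_null_bounded wy.
have [u u0 yu] : exists2 u : F, 0 <= u & forall n, modulus (y n) <= 2 ^+ n *: u.
  apply: (@weighted_dominant _ _ (fun n => modulus (y n)) M) => n.
    exact: modulus_ge0.
  by rewrite norm_modulus.
have [f pf ctrl] := controlling_functional hF u0.
have [Mf Mf0 fM] := posfun_bound pf.
have ui := weakly_null_uniformly_integrable pf wy u0 yu.
have [||psi1 ipsi1 hpsi1] := @hereditary_cesaro_null _ _ _ (posfun_seminorm pf) y (Mf
  * M).
- move=> i; rewrite (le_trans (ler_norm _))// (le_trans (fM _))// norm_modulus.
  by rewrite ler_wpM2l// ltW.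
- move=> eps psi eps0 ipsi.
  apply: (uniformly_integrable_small_average pf (weakly_null_subseq ipsi wy) u0 _ eps0).
  by move=> e e0; have [c c0 hc] := ui e e0; exists c => // n; exact: hc.
have [||psi2 ipsi2 hpsi2] := @hereditary_cesaro_null _ _ _ (seminorm_norm F) (y \o
  psi1) M.
- by move=> i; exact: yM.
- move=> eps psi eps0 ipsi.
  have ipp := increasing_seq_comp ipsi1 ipsi.
  have [chi ichi aob] := haob _ ipp.
  have ipc := increasing_seq_comp ipsi ichi.
  have c0 : cesaro_seq (y \o psi1 \o psi \o chi) @ \oo --> (0 : F).
    apply: (almost_order_bounded_cvg0 hF pf u0 ctrl _ aob).
      by move=> m; exact: (cesaro_seq_modulus_le m yu (psi1 \o psi \o chi) u0).
    exact: hpsi1 _ ipc.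
  have [m m0 hm] := cesaro_small_average c0 eps0.
  exists m, (map chi (iota m.+1 m)); split=> //.
  + by rewrite (increasing_seq_sorted _ ichi) iota_ltn_sorted.
  + by rewrite size_map size_iota.
  + apply/allP => _ /mapP[i + ->]; rewrite mem_iota => /andP[mi _].
    exact: leq_trans mi (increasing_seq_ge ichi i).
  + by rewrite big_map.
exists (psi1 \o psi2); first exact: increasing_seq_comp.
move=> chi ichi; apply: norm_cvg0; exact: hpsi2.
Qed.

End MainImplications.

Theorem proposition3p12 (R : realType) (E F : banachLatticeType R)
    (hE : order_continuous E) (hF : order_continuous F)
    (T : {linear E -> F}) (hT : bounded_operator T) :
  [<-> disjoint_weak_banach_saks T;
       forall x : nat -> E, (forall n, 0 <= x n) -> weakly_null x -> uo_null x ->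
         has_aob_cesaro_subseq (T \o x);
       forall x : nat -> E, (forall n, 0 <= x n) -> weakly_null x ->
         has_aob_cesaro_subseq (T \o x)].
Proof.
tfae.
- move=> dwbs x x0 wx uo.
  have [M xM] := weakly_null_bounded wx.
  have [phi hphi [d [d0 dx disj xd]]] := almost_disjoint_subseq x0 xM
    (fun i => uo_null_meet_cvg0 hE uo x0 (x0 i)).
  have xd0 : (fun k => x (phi k) - d k) @ \oo --> (0 : E) by exact: norm_cvg0.
  have wd : weakly_null d.
    move=> f fc.
    have -> : f \o d = (fun k => f (x (phi k)) - f (x (phi k) - d k)).
      by apply/funext => k /=; rewrite raddfB/= opprB addrC subrK.
    rewrite -[0 : R](subrr 0); apply: cvgB;
      first exact: (weakly_null_subseq hphi wx fc).
    by rewrite -[0 : R](raddf0 f); apply: continuous_cvg => //; exact: fc.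
  have dd : disjoint_seq d.
    by move=> m n mn; rewrite !modulus_id// disj// eq_sym.
  have [chi ichi cd] := dwbs d dd wd.
  exists (phi \o chi); first exact: increasing_seq_comp.
  apply: cvg_almost_order_bounded.
  have -> : cesaro_seq (T \o x \o (phi \o chi)) =
      (fun m => cesaro_seq (T \o d \o chi) m -
        cesaro_seq (fun k => - T (x (phi (chi k)) - d (chi k))) m).
    rewrite -cesaro_seqB; congr cesaro_seq; apply/funext => k /=.
    by rewrite opprK raddfB/= addrC subrK.
  apply: is_cvgB => //; apply/cvg_ex; exists 0; apply: cesaro_seq_cvg0.
  rewrite -(@oppr0 F); apply: cvgN; rewrite -(raddf0 T).
  apply: continuous_cvg; first exact: bounded_operator_continuous.
  apply: (cvg_comp chi (fun k => x (phi k) - d k)) xd0.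
  exact: increasing_seq_cvg.
- move=> h x x0 wx.
  have [phi hphi uo] := weakly_null_uo_null_subseq hE x0 wx.
  have [chi ichi aob] := h (x \o phi) (fun n =>
    x0 (phi n)) (weakly_null_subseq hphi wx) uo.
  by exists (phi \o chi); first exact: increasing_seq_comp.
- move=> h x dx wx.
  have hered (z : nat -> E) : (forall n, 0 <= z n) -> weakly_null z ->
      exists2 psi, increasing_seq psi & forall chi, increasing_seq chi ->
        cesaro_seq (T \o z \o psi \o chi) @ \oo --> (0 : F).
    move=> z0 wz; apply: hereditary_cesaro_null_image => // phi hphi.
    by apply: h; [move=> n; exact: z0|exact: weakly_null_subseq].
  have [psi1 ipsi1 h1] := hered _ (fun n =>
    pospart_ge0 (x n)) (weakly_null_pospart dx wx).
  have wxN := weakly_null_pospart (disjoint_seq_opp dx) (weakly_null_opp wx).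
  have [psi2 ipsi2 h2] := hered ((fun n => pospart (- x n)) \o psi1)
    (fun n => pospart_ge0 _) (weakly_null_subseq ipsi1 wxN).
  (* Both images are Cesàro null along the common subsequence, because this holds
     along all subsequences of psi1 for the positive parts. *)
  exists (psi1 \o psi2); first exact: increasing_seq_comp.
  apply/cvg_ex; exists (0 - 0).
  have -> : cesaro_seq (T \o x \o (psi1 \o psi2)) = (fun m =>
      cesaro_seq (T \o (fun n => pospart (x n)) \o psi1 \o psi2) m -
      cesaro_seq (T \o ((fun n => pospart (- x n)) \o psi1) \o psi2 \o id) m).
    rewrite -cesaro_seqB; congr cesaro_seq; apply/funext => k /=.
    by rewrite -raddfB/= pospartB.
  by apply: cvgB; [exact: h1|exact: h2].
Qed.
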